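(* Let $n\ge 2$. Given a vector $\mathfrak{c}\in\mathbb{N}^n$, the toric ring $\mathcal{B}(\mathfrak{c},K_n)$ is Gorenstein, where $K_n$ is the complete graph on $\{x_1,\ldots,x_n\}$. In particular, for any vector $\mathfrak{c}\in\mathbb{N}^n$ there is a finite graph $G$ (with no loop, no multiple edge and no isolated vertex) on $V(G)=\{x_1,\ldots,x_n\}$ for which $\mathcal{B}(\mathfrak{c},G)$ is Gorenstein.
   Context: $\mathbb{N}$ denotes the set of positive integers, $K$ is a field and $S=K[x_1,\ldots,x_n]$ is the polynomial ring. For a monomial ideal $I\subset S$ and $\mathfrak{c}=(c_1,\ldots,c_n)\in\mathbb{N}^n$, $I_{\mathfrak{c}}$ is the ideal generated by those monomials $x_1^{a_1}\cdots x_n^{a_n}\in I$ with $a_i\le c_i$ for all $i$; $\delta_{\mathfrak{c}}(I)$ is the largest integer $q$ for which $(I^q)_{\mathfrak{c}}\neq 0$. For a finite graph $G$ on $\{x_1,\ldots,x_n\}$ (no loop, no multiple edge, no isolated vertex), its edge ideal $I(G)\subset S$ is generated by the monomials $x_ix_j$ with $\{x_i,x_j\}\in E(G)$. If $\{w_1,\ldots,w_s\}$ is the minimal set of monomial generators of $(I(G)^{\delta})_{\mathfrak{c}}$ with $\delta=\delta_{\mathfrak{c}}(I(G))$, then $\mathcal{B}(\mathfrak{c},G):=K[w_1,\ldots,w_s]\subset S$. *)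

(* Defs.v *)
From HB Require Import structures.
From mathcomp Require Import all_boot all_algebra.
From mathcomp Require Import boolp classical_sets.
From mathcomp Require Import mpoly.

Set Implicit Arguments.
Unset Strict Implicit.
Unset Printing Implicit Defensive.

Import GRing.Theory.

Local Open Scope ring_scope.
Local Open Scope classical_set_scope.

Section Ideals.
Variable R : comNzRingType.
Implicit Types (A I m : set R).

Definition is_ideal I : Prop :=
  [/\ I 0, forall x y, I x -> I y -> I (x + y) & forall a x, I x -> I (a * x)].

Definition ideal_gen A : set R :=
  [set f | exists2 s : seq (R * R),
     (forall u, u \in s -> A u.2) & f = \sum_(u <- s) u.1 * u.2].

(* For q = 0 the only product is the empty one, so I^0 is the unit ideal. *)
Definition ideal_pow I (q : nat) : set R :=
  ideal_gen
    [set f | exists2 g : 'I_q -> R, forall i, I (g i) & f = \prod_i g i].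

Definition maximal_ideal m : Prop :=
  [/\ is_ideal m, ~ m 1 &
      forall I, is_ideal I -> ~ I 1 -> m `<=` I -> I = m].

Definition noetherian : Prop :=
  forall I, is_ideal I -> exists s : seq R, I = ideal_gen [set` s].

End Ideals.

Section Gorenstein.

(* phi : R -> L exhibits L as the localization of R at the prime ideal p;
   these conditions determine (L, phi) up to a unique isomorphism. *)
Definition is_localization (R : comNzRingType) (p : set R)
    (L : comNzRingType) (phi : {rmorphism R -> L}) : Prop :=
  [/\ forall s, ~ p s -> exists y, phi s * y = 1,
      forall x, exists a s, ~ p s /\ x * phi s = phi a
    & forall a, phi a = 0 -> exists2 s, ~ p s & s * a = 0].

Definition injective_module (R : comNzRingType) (E : lmodType R) : Prop :=
  forall (A B : lmodType R) (f : {linear A -> B}) (g : {linear A -> E}),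
    injective f -> exists h : {linear B -> E}, forall a, h (f a) = g a.

(* An exact sequence 0 -> M -> E 0 -> E 1 -> ... with every E i injective
   and E i = 0 for all i > d. *)
Definition injdim_le (R : comNzRingType) (M : lmodType R) (d : nat) : Prop :=
  exists (E : nat -> lmodType R) (e : {linear M -> E 0%N})
         (dE : forall i, {linear E i -> E i.+1}),
    [/\ injective e,
        range e = [set x | dE 0%N x = 0],
        forall i, range (dE i) = [set x | dE i.+1 x = 0],
        forall i, injective_module (E i)
      & forall i, (d < i)%N -> forall x : E i, x = 0].

Definition finite_injdim (R : comNzRingType) (M : lmodType R) : Prop :=
  exists d, injdim_le M d.

(* A Noetherian ring all of whose localizations at maximal ideals are
   Gorenstein local rings, i.e. have finite injective dimension over
   themselves (the localizations being automatically local and Noetherian). *)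
Definition gorenstein (R : comNzRingType) : Prop :=
  noetherian R /\
  forall m : set R, maximal_ideal m ->
    exists (L : comNzRingType) (phi : {rmorphism R -> L}),
      is_localization m phi /\ finite_injdim L^o.

End Gorenstein.

Section BoundedPowers.
Variables (K : fieldType) (n : nat).
Local Notation S := {mpoly K[n]}.
Implicit Types (c : 'I_n -> nat) (I J W : set S).

Definition monomials : set S := [set f | exists m : 'X_{1..n}, f = 'X_[m]].

Definition bounded_part c I : set S :=
  ideal_gen
    [set f | exists m : 'X_{1..n},
       [/\ f = 'X_[m], I 'X_[m] & forall i, (m i <= c i)%N]].

Definition bounded_pow_neq0 c I (q : nat) : Prop :=
  exists2 f, bounded_part c (ideal_pow I q) f & f != 0.

(* The default value 0 of xget is used only when there is no largest such q
   (e.g. for I = S). *)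
Definition delta c I : nat :=
  xget 0%N [set q | bounded_pow_neq0 c I q /\
                    forall q', bounded_pow_neq0 c I q' -> (q' <= q)%N].

Definition is_min_monomial_gens J W : Prop :=
  [/\ W `<=` monomials, ideal_gen W = J &
      forall W', W' `<=` W -> ideal_gen W' = J -> W' = W].

Definition min_monomial_gens J : set S := xget set0 (is_min_monomial_gens J).

(* The smallest K-subalgebra of S containing W, as a boolean predicate. *)
Definition subalg_gen W : {pred S} :=
  fun f => `[< forall P : {pred S},
    GRing.subalg_closed P -> (forall w, W w -> w \in P) -> f \in P >].

Lemma subalg_gen_closed W : GRing.subalg_closed (subalg_gen W).
Proof.
split.
- by apply/asboolP => P [].
- move=> a u v /asboolP hu /asboolP hv; apply/asboolP => P hP hW.
  by case: (hP) => _ + _; apply; [apply: hu | apply: hv].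
- move=> u v /asboolP hu /asboolP hv; apply/asboolP => P hP hW.
  by case: (hP) => _ _; apply; [apply: hu | apply: hv].
Qed.

HB.instance Definition _ W :=
  GRing.isSubringClosed.Build S (subalg_gen W)
    (GRing.subalg_closedBM (subalg_gen_closed W)).

Definition subalg W : Type := {f : S | f \in subalg_gen W}.

HB.instance Definition _ W := [isSub of subalg W for @sval _ _].
HB.instance Definition _ W := [Choice of subalg W by <:].
HB.instance Definition _ W := [SubChoice_isSubComNzRing of subalg W by <:].

(* A graph on the vertex set {x_1, ..., x_n} is given by its adjacency
   relation on 'I_n. *)
Definition is_graph (e : rel 'I_n) : Prop :=
  [/\ ssrbool.symmetric e, irreflexive e & forall i, exists j, e i j].

Definition complete_graph : rel 'I_n := fun i j => i != j.

Definition edge_ideal (e : rel 'I_n) : set S :=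
  ideal_gen [set f | exists i j, e i j /\ f = 'X_i * 'X_j].

Definition toric_ring c (e : rel 'I_n) : comNzRingType :=
  subalg (min_monomial_gens
    (bounded_part c (ideal_pow (edge_ideal e) (delta c (edge_ideal e))))).

End BoundedPowers.

(* Main.v *)
Require Import Defs.
From HB Require Import structures.
From mathcomp Require Import all_boot all_algebra.
From mathcomp Require Import boolp classical_sets functions.
From mathcomp Require Import mpoly ring zify.

Set Implicit Arguments.
Unset Strict Implicit.
Unset Printing Implicit Defensive.

Import GRing.Theory.

Local Open Scope ring_scope.
Local Open Scope classical_set_scope.

(** Write [c] for the bounding vector and let [a] range over exponent vectors.
A monomial of degree [2q] lies in the [q]-th power of the edge ideal of the
complete graph exactly when none of its exponents exceeds [q]: necessity is
clear because an edge uses each vertex at most once, and sufficiency holds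
because removing the edge between the two largest exponents preserves the
condition ([balanced_edge]). Finding the generators of the top bounded power
is therefore a matter of counting. If some [c i] is at least the sum of the
other entries, or if the sum of all entries is even, there is a single
generator; otherwise the generators are the [n] monomials [x^c / x_i], whose
exponent vectors are linearly independent. In every case the toric ring is a
polynomial ring over [K] ([gorenstein_monomial_subalg]).

What remains is that polynomial rings over a field are Gorenstein in the sense
of injective dimension. Noetherianity is Hilbert's basis theorem. For the
injective dimension, say that a ring [A] is of level [d] if, for every
[A]-module [M], the [d]-th cosyzygy in every injective coresolution of [M] is
injective ([cosyzygies_injective]). A field is of level 0. If [A] is of level
[d], then [A[X]] is of level [d + 1]: let [C] be a [d]-th cosyzygy over [A[X]].
Injective [A[X]]-modules are injective over [A], so [C] is a [d]-th cosyzygy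
over [A] as well, hence [A]-injective; the coinduced module [Co = Hom_A(A[X],C)]
is then injective over [A[X]], and there is a short exact sequence
[0 -> C -> Co -> Co -> 0] whose second map sends [f] to
[r |-> f(X r) - X f(r)] ([poly_coind_short_exact]). This coresolution of [C] has
length one, and a Schanuel-type argument ([cokernel_injective]) shows that the
next cosyzygy of [C] is injective whatever coresolution is used. A localization
[L] of [S] inherits the level of [S], because injective [L]-modules are
injective over [S], while [S]-linear maps between [L]-modules are [L]-linear.

To turn the level of [L] into a finite injective coresolution of [L], every
module has to embed in an injective one. Over a [K]-algebra [R] the module
[Hom_K(R,M)] serves, since all [K]-modules are injective by Baer's criterion,
and the quotient of [Hom_K(R,M)] by [M] has an explicit model: the functions
vanishing at 1, with a twisted action ([cosyz]). *)

(** * Baer's criterion *)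

Lemma linear_exists (R : comNzRingType) (U V : lmodType R) (f : U -> V) :
  linear f -> exists g : {linear U -> V}, forall x, g x = f x.
Proof.
move=> lin; pose L := GRing.isLinear.Build R U V _ f lin.
by pose g : {linear U -> V} := HB.pack f L; exists g.
Qed.

Section Baer.
Variable R : comNzRingType.

(** The property tested by Baer's criterion, with a morphism on an ideal
encoded as a function on the whole ring that is additive and homogeneous on the
ideal: checking it does not involve modules carried by ideals. *)
Definition extends_from_ideals (E : lmodType R) : Prop :=
  forall (I : set R) (g : R -> E), is_ideal I ->
    (forall x y, I x -> I y -> g (x + y) = g x + g y) ->
    (forall a x, I x -> g (a * x) = a *: g x) ->
    exists e, forall x, I x -> g x = x *: e.

Section Extension.
Variables (E A B : lmodType R) (f : {linear A -> B}) (g : {linear A -> E}).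
Hypothesis f_inj : injective f.

(** The graph of a linear map to [E] that is defined on a submodule of [B]
containing the range of [f] and that extends [g] along [f]. Graphs, rather than
maps on varying domains, are what Zorn's lemma for inclusion applies to. *)
Record partial_extension (G : set (B * E)) : Prop := PartialExtension {
  pext_base : forall a, G (f a, g a);
  pext_lin : forall a u v, G u -> G v -> G (a *: u.1 + v.1, a *: u.2 + v.2);
  pext_fun : forall e, G (0, e) -> e = 0 }.

Lemma pext_uniq G b e e' : partial_extension G -> G (b, e) -> G (b, e') -> e = e'.
Proof.
move=> [_ Gl Gf] h h'; apply/eqP; rewrite -subr_eq0; apply/eqP/Gf.
have /= := Gl (-1) _ _ h' h.
by rewrite !scaleN1r addNr [- e' + e]addrC.
Qed.

Lemma pext_zero G : partial_extension G -> G (0, 0).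
Proof. by move=> [Gb _ _]; have := Gb 0; rewrite !linear0. Qed.

Lemma pext_graph : partial_extension (range (fun a => (f a, g a))).
Proof.
split.
- by move=> a; exists a.
- move=> a _ _ [x _ <-] [y _ <-] /=; exists (a *: x + y) => //.
  by rewrite !linearP.
- move=> e [x _ [fx0 <-]]; rewrite -(linear0 f) in fx0.
  by rewrite (f_inj fx0) linear0.
Qed.

(** The empty graph is adjoined to the ordered set so that the empty chain has
an upper bound; a maximal element is nonempty since [pext_graph] exceeds it. *)
Lemma pext_maximal : exists2 G, partial_extension G &
  forall G', partial_extension G' -> G `<=` G' -> G' = G.
Proof.
pose P G := G = set0 \/ partial_extension G.
have [F FP Ftot|G [PG Gmax]] := @Zorn_bigcup _ P.
  have [[X FX pX]|noF] := pselect (exists2 X, F X & partial_extension X).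
    right; split.
    - by move=> a; exists X => //; case: pX.
    - move=> a u v [Y FY Yu] [Z FZ Zv].
      have [YZ|ZY] := Ftot _ _ FY FZ.
        exists Z => //; case: (FP _ FZ) => [Z0|[_ Zl _]]; first by rewrite Z0 in Zv.
        by apply: Zl => //; apply: YZ.
      exists Y => //; case: (FP _ FY) => [Y0|[_ Yl _]]; first by rewrite Y0 in Yu.
      by apply: Yl => //; apply: ZY.
    - move=> e [Y FY Ye]; case: (FP _ FY) => [Y0|[_ _ Yf]].
        by rewrite Y0 in Ye.
      exact: Yf.
  left; rewrite predeqE => u; split=> // -[X FX Xu].
  case: (FP _ FX) => [X0|pX]; first by rewrite X0 in Xu.
  by case: noF; exists X.
have pG : partial_extension G.
  case: PG => // G0; exfalso.
  apply: (Gmax (range (fun a => (f a, g a)))); last by right; exact: pext_graph.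
  rewrite G0; split=> // /(_ (f 0, g 0)); apply; by exists 0.
exists G => // G' pG' GG'; apply: contrapT => ne.
apply: (Gmax G'); last by right.
by split=> // G'G; apply: ne; rewrite eqEsubset.
Qed.

(** If a maximal extension missed a vector [b], the scalars [r] such that
[r *: b] is in its domain would form an ideal; the hypothesis on [E] provides a
value [e0] at [b] that is consistent with the extension on these multiples. *)
Lemma baer_extension : extends_from_ideals E ->
  exists h : {linear B -> E}, forall a, h (f a) = g a.
Proof.
move=> Einj; have [G pG Gmax] := pext_maximal.
pose val b := xget 0 [set e | G (b, e)].
have valP b e : G (b, e) -> G (b, val b).
  by move=> Gbe; exact: (@xgetI _ 0 [set e | G (b, e)] e).
have valE b e : G (b, e) -> val b = e.
  by move=> Gbe; exact: (pext_uniq pG (valP _ _ Gbe) Gbe).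
have Gl := pext_lin pG.
have Gtot b : G (b, val b).
  pose I := [set r : R | exists e, G (r *: b, e)].
  have IG r : I r -> G (r *: b, val (r *: b)) by move=> [e /valP].
  have idI : is_ideal I.
    split.
    - by exists 0; rewrite scale0r; exact: pext_zero.
    - move=> x y [e xe] [e' ye]; exists (e + e').
      by have /= := Gl 1 _ _ xe ye; rewrite !scale1r scalerDl.
    - move=> a x [e xe]; exists (a *: e).
      by have /= := Gl a _ _ xe (pext_zero pG); rewrite !addr0 scalerA.
  have [||e0 e0P] := Einj I (fun r => val (r *: b)) idI.
  - move=> x y /IG xe /IG ye; apply: valE.
    by have /= := Gl 1 _ _ xe ye; rewrite !scale1r scalerDl.
  - move=> a x /IG xe; apply: valE.
    by have /= := Gl a _ _ xe (pext_zero pG); rewrite !addr0 scalerA.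
  pose G' := [set u | exists v r, G v /\ u = (v.1 + r *: b, v.2 + r *: e0)].
  have GG' : G `<=` G'.
    by move=> [x e] Gu; exists (x, e), 0; rewrite !scale0r !addr0.
  have pG' : partial_extension G'.
    split.
    - by move=> a; apply: GG'; exact: pext_base.
    - move=> a _ _ [v [r [Gv ->]]] [w [s [Gw ->]]] /=.
      exists (a *: v.1 + w.1, a *: v.2 + w.2), (a * r + s); split; first exact: Gl.
      by congr pair => /=; rewrite scalerDr scalerDl scalerA !addrA;
        congr (_ + _); rewrite -!addrA; congr (_ + _); rewrite addrC.
    - move=> e [[x e'] [r [Gv /= [x0 ->]]]].
      have xE : x = - (r *: b) by apply/eqP; rewrite -addr_eq0 -x0.
      have Gr : G (r *: b, - e').
        have /= := Gl (-1) _ _ Gv (pext_zero pG).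
        by rewrite !addr0 !scaleN1r xE opprK.
      by rewrite -(e0P r) ?(valE _ _ Gr) ?subrr//; exists (- e').
  have := Gmax _ pG' GG' => G'E.
  apply: (valP b e0); rewrite -G'E; exists (0, 0), 1; split; first exact: pext_zero.
  by rewrite !add0r !scale1r.
have lin : linear val.
  by move=> a x y; apply: valE; have /= := Gl a _ _ (Gtot x) (Gtot y).
have [h hE] := linear_exists lin.
by exists h => a; rewrite hE; apply: valE; exact: pext_base.
Qed.

End Extension.

Lemma baer_injective (E : lmodType R) :
  extends_from_ideals E -> injective_module E.
Proof. by move=> Einj A B f g f_inj; exact: baer_extension. Qed.

Section IdealModule.
Variables (I : set R) (idI : is_ideal I).

Definition ideal_pred : {pred R^o} := fun x => `[< I x >].

Lemma ideal_submod_closed : GRing.submod_closed ideal_pred.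
Proof.
case: idI => I0 ID IM; split; first exact/asboolP.
by move=> a u v /asboolP Iu /asboolP Iv; apply/asboolP/ID/Iv; exact: IM.
Qed.
End IdealModule.

(** The structures of [ideal_module] must be inferred from its argument alone,
so an ideal comes bundled with the proof that it is one. *)
Section IdealModuleType.
Variables (I : {I : set R | is_ideal I}).
HB.instance Definition _ := GRing.isSubmodClosed.Build R R^o (ideal_pred (sval I))
  (ideal_submod_closed (svalP I)).
Definition ideal_module : Type := {x : R^o | ideal_pred (sval I) x}.
HB.instance Definition _ := [isSub of ideal_module for @sval _ _].
HB.instance Definition _ := [Choice of ideal_module by <:].
HB.instance Definition _ := [SubChoice_isSubLmodule of ideal_module by <:].
End IdealModuleType.

Lemma injective_extends_from_ideals (E : lmodType R) :
  injective_module E -> extends_from_ideals E.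
Proof.
move=> Einj I g idI gD gM; pose J := exist _ I idI : {I : set R | is_ideal I}.
have JI (x : ideal_module J) : I (val x) by case: x => x /= /asboolP.
have lin : linear (fun x : ideal_module J => g (val x)).
  have [_ _ IM] := idI.
  move=> a x y; rewrite /= gD ?gM//;
    [exact: JI | apply: IM; exact: JI | exact: JI].
have [gl glE] := linear_exists lin.
have [h hP] := Einj _ R^o (val : {linear ideal_module J -> R^o}) gl val_inj.
exists (h 1) => x Ix.
have Jx : ideal_pred (sval J) x by apply/asboolP.
have /= := hP (exist _ x Jx : ideal_module J); rewrite glE /= => <-.
by rewrite -linearZ /= /GRing.scale /= mulr1.
Qed.

End Baer.

(** * Restriction and coinduction of modules *)

(** The morphism [psi] is a parameter of this alias of [M] because the scalar
action, which is found by unification on the type, depends on it. *)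
Definition restrict (A R : comNzRingType) (psi : {rmorphism A -> R})
  (M : lmodType R) : Type := M.

Section Restriction.
Variables (A R : comNzRingType) (psi : {rmorphism A -> R}).
Local Notation restrict := (restrict psi).

Section RestrictionModule.
Variable M : lmodType R.
HB.instance Definition _ := GRing.Zmodule.on (restrict M).

Let scale (a : A) (x : restrict M) : restrict M := psi a *: (x : M).
Fact restrict_scaleA a b x : scale a (scale b x) = scale (a * b) x.
Proof. by rewrite /scale scalerA rmorphM. Qed.
Fact restrict_scale1 : left_id 1 scale.
Proof. by move=> x; rewrite /scale rmorph1 scale1r. Qed.
Fact restrict_scaleDr : right_distributive scale +%R.
Proof. by move=> a x y; rewrite /scale scalerDr. Qed.
Fact restrict_scaleDl x : {morph scale^~ x : a b / a + b}.
Proof. by move=> a b; rewrite /scale rmorphD scalerDl. Qed.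
HB.instance Definition _ := GRing.Zmodule_isLmodule.Build A (restrict M)
  restrict_scaleA restrict_scale1 restrict_scaleDr restrict_scaleDl.

Lemma restrict_scaleE a (x : restrict M) : a *: x = psi a *: (x : M) :> M.
Proof. by []. Qed.
End RestrictionModule.

Lemma restrict_linear (M N : lmodType R) (f : {linear M -> N}) :
  exists g : {linear restrict M -> restrict N}, forall x, g x = f x.
Proof. 
apply: (@linear_exists A (restrict M) (restrict N) f) => a x y.
by rewrite linearD [in LHS]restrict_scaleE linearZ.
Qed.

Section Coinduction.
Variable M : lmodType R.

(** [coind] is the [R]-module [Hom_A(R,M)], on which a scalar [r] acts by
precomposition with multiplication by [r]. *)
Definition coind_pred : {pred R -> M} := fun f =>
  `[< forall a x y, f (psi a * x + y) = psi a *: f x + f y >].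

Lemma coind_zmod_closed : zmod_closed coind_pred.
Proof.
split.
  by apply/asboolP => a x y; rewrite /= scaler0 addr0.
move=> f g /asboolP fP /asboolP gP; apply/asboolP => a x y.
rewrite -[LHS]/(f (psi a * x + y) - g (psi a * x + y)).
rewrite -[RHS]/(psi a *: (f x - g x) + (f y - g y)).
by rewrite fP gP scalerBr opprD addrACA.
Qed.
HB.instance Definition _ :=
  GRing.isZmodClosed.Build (R -> M) coind_pred coind_zmod_closed.

Record coind : Type := Coind {
  coind_val :> R -> M;
  coind_valP : coind_val \in coind_pred }.
HB.instance Definition _ := [isSub for coind_val].
HB.instance Definition _ := [Choice of coind by <:].
HB.instance Definition _ := [SubChoice_isSubZmodule of coind by <:].

Lemma coindP (f : coind) a x y : f (psi a * x + y) = psi a *: f x + f y.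
Proof. by case: f => f /= /asboolP. Qed.

Lemma coindDE (f g : coind) x : (f + g) x = f x + g x. Proof. by []. Qed.
Lemma coindNE (f : coind) x : (- f) x = - f x. Proof. by []. Qed.

Lemma coindD (f : coind) x y : f (x + y) = f x + f y.
Proof. by have := coindP f 1 x y; rewrite rmorph1 mul1r scale1r. Qed.
Lemma coind0 (f : coind) : f 0 = 0.
Proof. by apply: (addrI (f 0)); rewrite -coindD !addr0. Qed.
Lemma coindZ (f : coind) a x : f (psi a * x) = psi a *: f x.
Proof. by have := coindP f a x 0; rewrite !addr0 coind0 addr0. Qed.

Lemma coind_eq (f g : coind) : (forall x, f x = g x) -> f = g.
Proof. by move=> fg; apply/val_inj/funext. Qed.

Lemma coind_exists (f : R -> M) :
  (forall a x y, f (psi a * x + y) = psi a *: f x + f y) ->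
  exists g : coind, forall x, g x = f x.
Proof. by move=> /asboolP fP; exists (Coind fP). Qed.

Fact coind_scale_subproof (r : R) (f : coind) :
  (fun x => f (x * r)) \in coind_pred.
Proof. by apply/asboolP => a x y; rewrite mulrDl -mulrA coindP. Qed.
Let scale r f := Coind (coind_scale_subproof r f).
Fact coind_scaleA a b x : scale a (scale b x) = scale (a * b) x.
Proof. by apply: coind_eq => y /=; rewrite -mulrA. Qed.
Fact coind_scale1 : left_id 1 scale.
Proof. by move=> f; apply: coind_eq => y /=; rewrite mulr1. Qed.
Fact coind_scaleDr : right_distributive scale +%R.
Proof. by move=> a x y; apply: coind_eq. Qed.
Fact coind_scaleDl x : {morph scale^~ x : a b / a + b}.
Proof. by move=> a b; apply: coind_eq => y; rewrite coindDE /= mulrDr coindD. Qed.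
HB.instance Definition _ := GRing.Zmodule_isLmodule.Build R coind
  coind_scaleA coind_scale1 coind_scaleDr coind_scaleDl.

Lemma coind_scaleE r (f : coind) x : (r *: f) x = f (x * r). Proof. by []. Qed.

(** Coinduction is right adjoint to the exact functor of restriction: an
[R]-linear map [k] to the coinduced module corresponds to the [A]-linear map
[v |-> k v 1], from which it is recovered by [k v r = k (r *: v) 1]. *)
Lemma coind_injective : injective_module (restrict M) -> injective_module coind.
Proof.
move=> Minj U V f g f_inj.
have [f' f'E] := restrict_linear f.
have [g' g'E] :
    exists g' : {linear restrict U -> restrict M}, forall x, g' x = g x 1.
  apply: (@linear_exists A (restrict U) (restrict M) (fun x => g x 1)) => a x y.
  rewrite linearD coindDE [in LHS]restrict_scaleE linearZ coind_scaleE mul1r.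
  by rewrite -[psi a]mulr1 coindZ.
have [|h hP] := Minj _ _ f' g'; first by move=> x y; rewrite !f'E => /f_inj.
have hC v : exists k : coind, forall r, k r = h (r *: v).
  apply: coind_exists => a x y.
  rewrite scalerDl -scalerA.
  exact: (linearP h a (x *: v : restrict V) (y *: v : restrict V)).
pose k v := projT1 (cid (hC v)).
have kE v r : k v r = h (r *: v) by rewrite /k; case: cid.
have klin : linear k.
  move=> a u v; apply: coind_eq => r.
  by rewrite coindDE coind_scaleE !kE -linearD scalerDr scalerA.
have [k' k'E] := linear_exists klin.
exists k' => a; apply: coind_eq => r.
by rewrite k'E kE -linearZ -f'E hP g'E linearZ coind_scaleE mul1r.
Qed.

Fact coind_unit_subproof (m : M) : (fun x : R => x *: m) \in coind_pred.
Proof. by apply/asboolP => a x y; rewrite scalerDl scalerA. Qed.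
Definition coind_unit m := Coind (coind_unit_subproof m).
Lemma coind_unitE m x : coind_unit m x = x *: m. Proof. by []. Qed.
Fact coind_unit_linear : linear coind_unit.
Proof.
move=> a u v; apply: coind_eq => x.
by rewrite coindDE coind_scaleE !coind_unitE scalerDr scalerA.
Qed.
HB.instance Definition _ :=
  GRing.isLinear.Build R M coind _ coind_unit coind_unit_linear.
Lemma coind_unit_inj : injective coind_unit.
Proof.
by move=> u v /(congr1 (fun f : coind => f 1)); rewrite !coind_unitE !scale1r.
Qed.

(** The cokernel of [coind_unit], without passing to a quotient: evaluation at 1
is an additive retraction of [coind_unit], so the functions vanishing at 1
represent each class once. Since evaluation at 1 is not [R]-linear, the action
of [R] on them has to be corrected by [cosyz_proj]. *)
Definition cosyz_pred : {pred coind} := fun f => f 1 == 0.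
Lemma cosyz_zmod_closed : zmod_closed cosyz_pred.
Proof.
split; first exact/eqP.
move=> f g /eqP f1 /eqP g1; apply/eqP.
by rewrite coindDE coindNE f1 g1 subr0.
Qed.
HB.instance Definition _ :=
  GRing.isZmodClosed.Build coind cosyz_pred cosyz_zmod_closed.

Record cosyz : Type := Cosyz {
  cosyz_val :> coind;
  cosyz_valP : cosyz_val \in cosyz_pred }.
HB.instance Definition _ := [isSub for cosyz_val].
HB.instance Definition _ := [Choice of cosyz by <:].
HB.instance Definition _ := [SubChoice_isSubZmodule of cosyz by <:].

Lemma cosyz1 (f : cosyz) : f 1 = 0. Proof. by case: f => f /= /eqP. Qed.
Lemma cosyzDE (f g : cosyz) x : (f + g) x = f x + g x. Proof. by []. Qed.
Lemma cosyz_eq (f g : cosyz) : (forall x, f x = g x) -> f = g.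
Proof. by move=> fg; apply/val_inj/coind_eq. Qed.

Fact cosyz_proj_subproof (f : coind) : f - coind_unit (f 1) \in cosyz_pred.
Proof. by apply/eqP; rewrite coindDE coindNE coind_unitE scale1r subrr. Qed.
Definition cosyz_proj f := Cosyz (cosyz_proj_subproof f).
Lemma cosyz_projE f x : cosyz_proj f x = f x - x *: f 1. Proof. by []. Qed.

Let scaleq (r : R) (f : cosyz) := cosyz_proj (r *: (f : coind)).
Lemma scaleqE r f x : scaleq r f x = f (x * r) - x *: f r.
Proof. by rewrite cosyz_projE !coind_scaleE mul1r. Qed.
Fact cosyz_scaleA a b x : scaleq a (scaleq b x) = scaleq (a * b) x.
Proof.
apply: cosyz_eq => y; rewrite !scaleqE scalerBr scalerA mulrA.
by rewrite opprB addrA subrK.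
Qed.
Fact cosyz_scale1 : left_id 1 scaleq.
Proof.
move=> f; apply: cosyz_eq => y.
by rewrite scaleqE mulr1 cosyz1 scaler0 subr0.
Qed.
Fact cosyz_scaleDr : right_distributive scaleq +%R.
Proof.
move=> a x y; apply: cosyz_eq => z.
by rewrite cosyzDE !scaleqE !cosyzDE scalerDr opprD addrACA.
Qed.
Fact cosyz_scaleDl x : {morph scaleq^~ x : a b / a + b}.
Proof.
move=> a b; apply: cosyz_eq => y.
by rewrite cosyzDE !scaleqE mulrDr !coindD scalerDr opprD addrACA.
Qed.
HB.instance Definition _ := GRing.Zmodule_isLmodule.Build R cosyz
  cosyz_scaleA cosyz_scale1 cosyz_scaleDr cosyz_scaleDl.
Lemma cosyz_scaleE r (f : cosyz) x : (r *: f) x = f (x * r) - x *: f r.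
Proof. exact: scaleqE. Qed.

Fact cosyz_proj_linear : linear cosyz_proj.
Proof.
move=> a f g; apply: cosyz_eq => x.
rewrite cosyzDE cosyz_scaleE !cosyz_projE !coindDE !coind_scaleE mul1r.
rewrite scalerDr opprD addrACA scalerBr scalerA; congr (_ + _).
by rewrite opprB addrA subrK.
Qed.
HB.instance Definition _ :=
  GRing.isLinear.Build R coind cosyz _ cosyz_proj cosyz_proj_linear.

Lemma cosyz_valK (f : cosyz) : cosyz_proj f = f.
Proof. by apply: cosyz_eq => x; rewrite cosyz_projE cosyz1 scaler0 subr0. Qed.
Lemma cosyz_proj_ker (f : coind) : cosyz_proj f = 0 -> f = coind_unit (f 1).
Proof.
move=> f0; apply: coind_eq => x; apply/eqP; rewrite -subr_eq0.
by have := cosyz_projE f x; rewrite f0 => <-.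
Qed.
Lemma cosyz_proj_unit m : cosyz_proj (coind_unit m) = 0.
Proof. by apply: cosyz_eq => x; rewrite cosyz_projE !coind_unitE scale1r subrr. Qed.

End Coinduction.
End Restriction.

(** * Cosyzygies and injective dimension *)

Section Cosyzygies.
Variable R : comNzRingType.

Definition short_exact (M E C : lmodType R) (i : {linear M -> E})
    (p : {linear E -> C}) : Prop :=
  [/\ injective i, forall c, exists e, p e = c
    & forall e, p e = 0 <-> exists m, i m = e].

(** The cokernels that occur in arbitrary injective coresolutions of [M]; no
coresolution is preferred, so that the notion is stable under restriction of
scalars. *)
Inductive cosyzygy (M : lmodType R) : nat -> lmodType R -> Prop :=
| Cosyzygy0 : cosyzygy M 0 M
| CosyzygyS d (C E C' : lmodType R) (i : {linear C -> E}) (p : {linear E -> C'}) :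
    cosyzygy M d C -> injective_module E -> short_exact i p ->
    cosyzygy M d.+1 C'.

Lemma cosyzygy_cons (M E C : lmodType R) (i : {linear M -> E})
    (p : {linear E -> C}) d X :
  injective_module E -> short_exact i p -> cosyzygy C d X ->
  cosyzygy M d.+1 X.
Proof.
move=> Einj ip; elim=> [|{}d {}X E' C' i' p' _ CX E'inj ip'].
  exact: CosyzygyS (Cosyzygy0 M) Einj ip.
exact: CosyzygyS CX E'inj ip'.
Qed.

Definition cosyzygies_injective d : Prop :=
  forall M C, cosyzygy M d C -> injective_module C.

Definition enough_injectives : Prop := forall M : lmodType R,
  exists (E C : lmodType R) (i : {linear M -> E}) (p : {linear E -> C}),
    injective_module E /\ short_exact i p.

(** Matrices with no column serve as the zero module that pads coresolutions. *)
Lemma zero_injective : injective_module ('rV[R]_0 : lmodType R).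
Proof.
move=> A B f g _; have [h hE] := @linear_exists R B 'rV[R]_0 (fun=> 0)
  (fun a u v => esym (etrans (addr0 _) (scaler0 _ a))).
by exists h => a; rewrite hE thinmx0 [RHS]thinmx0.
Qed.

Lemma injdim_le0 (M : lmodType R) : injective_module M -> injdim_le M 0.
Proof.
move=> Minj; pose Z : lmodType R := 'rV[R]_0.
pose E i := if i is 0 then M else Z.
have Zlin (U : lmodType R) : linear (fun _ : U => 0 : Z).
  by move=> a u v; rewrite scaler0 addr0.
pose dE i : {linear E i -> E i.+1} := projT1 (cid (linear_exists (Zlin (E i)))).
have dE0 i x : dE i x = 0 by rewrite /dE; case: cid => /= h ->.
have Z0 (x y : Z) : x = y by apply/rowP => -[].
exists E, (idfun : {linear M -> M}), dE; split.
- by [].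
- by rewrite predeqE => x; split=> // _; exists x.
- move=> i; rewrite predeqE => x; split=> // _; exists 0 => //; exact: Z0.
- by case=> [|i] //=; exact: zero_injective.
- by case=> // i _ x; exact: Z0.
Qed.

(** Splices [0 -> M -> E -> C -> 0] with a coresolution of [C]. *)
Lemma injdim_leS (M E C : lmodType R) (i : {linear M -> E})
    (p : {linear E -> C}) d :
  injective_module E -> short_exact i p -> injdim_le C d -> injdim_le M d.+1.
Proof.
move=> Einj [i_inj p_surj ipK] [F [e [dF [e_inj eK dFK Finj F0]]]].
pose G k := if k is k'.+1 then F k' else E.
pose dG k : {linear G k -> G k.+1} :=
  match k return {linear G k -> G k.+1} with
  | 0 => (e \o p : {linear E -> F 0%N})
  | k'.+1 => dF k'
  end.
exists G, i, dG; split.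
- exact: i_inj.
- rewrite predeqE => x /=; split.
    move=> [m _ mx]; have /ipK -> := ex_intro (fun m => i m = x) m mx.
    exact: linear0.
  move=> /= ex0; have /ipK[m mx] : p x = 0 by apply: e_inj; rewrite linear0.
  by exists m.
- case=> [|k] /=; last exact: dFK.
  rewrite -eK predeqE => x; split.
    by move=> [m _ <-] /=; exists (p m).
  by move=> [c _ <-]; have [m <-] := p_surj c; exists m.
- by case.
- by case=> // k kd x; exact: F0.
Qed.

Lemma injdim_le_cosyzygies d (M : lmodType R) : enough_injectives ->
  (forall C, cosyzygy M d C -> injective_module C) -> injdim_le M d.
Proof.
move=> enough; elim: d M => [|d IHd] M Mcosyz.
  by apply: injdim_le0; apply: Mcosyz; exact: Cosyzygy0.
have [E [C [i [p [Einj ip]]]]] := enough M.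
apply: (injdim_leS Einj ip); apply: IHd => X CX.
by apply: Mcosyz; exact: cosyzygy_cons Einj ip CX.
Qed.

Lemma factor_cokernel (M E C X : lmodType R) (i : {linear M -> E})
    (p : {linear E -> C}) (u : {linear E -> X}) :
  short_exact i p -> (forall m, u (i m) = 0) ->
  exists v : {linear C -> X}, forall e, v (p e) = u e.
Proof.
move=> [_ p_surj ipK] ui0.
pose s c := projT1 (cid (p_surj c)).
have sK c : p (s c) = c by rewrite /s; case: cid.
have uE e e' : p e = p e' -> u e = u e'.
  move=> pe; apply/eqP; rewrite -subr_eq0 -linearB.
  have /ipK[m <-] : p (e - e') = 0 by rewrite linearB /= pe subrr.
  by rewrite ui0.
have lin : linear (fun c => u (s c)).
  by move=> a x y; rewrite -linearP; apply: uE; rewrite linearP !sK.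
have [v vE] := linear_exists lin.
by exists v => e; rewrite vE; apply: uE; rewrite sK.
Qed.

(** Schanuel's argument: comparing the two coresolutions of [M] in both
directions gives maps [a' : C -> I1] and [b' : I1 -> C] whose composite
[b' \o a'] differs from the identity of [C] by a map factoring through [E].
Hence the identity of [C] factors through the sum of [I1] and [E], and a map to
[C] extends because its two components do. *)
Lemma cokernel_injective (M I0 I1 E C : lmodType R)
    (i : {linear M -> I0}) (p : {linear I0 -> I1})
    (j : {linear M -> E}) (q : {linear E -> C}) :
  short_exact i p -> short_exact j q ->
  injective_module I0 -> injective_module I1 -> injective_module E ->
  injective_module C.
Proof.
move=> ip jq I0inj I1inj Einj U V f g f_inj.
have [i_inj p_surj ipK] := ip; have [j_inj q_surj jqK] := jq.
have [alpha alphaE] := I0inj _ _ j i j_inj.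
have [beta betaE] := Einj _ _ i j i_inj.
have p0 m : p (i m) = 0 by apply/ipK; exists m.
have q0 m : q (j m) = 0 by apply/jqK; exists m.
have [a' a'E] : exists a' : {linear C -> I1}, forall e, a' (q e) = p (alpha e).
  apply: (@factor_cokernel _ _ _ _ j q (p \o alpha) jq) => m /=.
  by rewrite alphaE p0.
have [b' b'E] : exists b' : {linear I1 -> C}, forall e, b' (p e) = q (beta e).
  apply: (@factor_cokernel _ _ _ _ i p (q \o beta) ip) => m /=.
  by rewrite betaE q0.
have [c cE] : exists c : {linear C -> E}, forall e, c (q e) = beta (alpha e) - e.
  have lin : linear (fun e => beta (alpha e) - e).
    by move=> a x y; rewrite (linearP alpha) (linearP beta) scalerBr opprD addrACA.
  have [u uE] := linear_exists lin.
  have [|c cE] := @factor_cokernel _ _ _ _ j q u jq.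
    by move=> m; rewrite uE alphaE betaE subrr.
  by exists c => e; rewrite cE uE.
have idE x : x = b' (a' x) - q (c x).
  have [e <-] := q_surj x.
  by rewrite a'E b'E cE linearB opprB addrC subrK.
have [h1 h1E] := I1inj _ _ f (a' \o g) f_inj.
have [h2 h2E] := Einj _ _ f (c \o g) f_inj.
have lin : linear (fun x => b' (h1 x) - q (h2 x)).
  move=> a x y; rewrite (linearP h1) (linearP b') (linearP h2) (linearP q).
  by rewrite scalerBr opprD addrACA.
have [h hE] := linear_exists lin.
by exists h => x; rewrite hE h1E h2E /= -idE.
Qed.

End Cosyzygies.

Section ChangeOfRings.
Variables (A R : comNzRingType) (psi : {rmorphism A -> R}).

(** This holds whenever [psi] is flat; the two cases of interest, polynomial
extensions and localizations, are obtained from Baer's criterion by extending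
an ideal of [A] to [R]. *)
Definition restriction_preserves_injectives : Prop :=
  forall E : lmodType R, injective_module E -> injective_module (restrict psi E).

Lemma restrict_short_exact (M E C : lmodType R) (i : {linear M -> E})
    (p : {linear E -> C}) : short_exact i p ->
  exists (i' : {linear restrict psi M -> restrict psi E})
         (p' : {linear restrict psi E -> restrict psi C}), short_exact i' p'.
Proof.
move=> [i_inj p_surj ipK].
have [i' i'E] := restrict_linear psi i; have [p' p'E] := restrict_linear psi p.
exists i', p'; split.
- by move=> x y; rewrite !i'E => /i_inj.
- by move=> c; have [e <-] := p_surj c; exists e; rewrite p'E.
- move=> e; rewrite p'E; split=> [/ipK[m <-]|[m]]; first by exists m; rewrite i'E.
  by rewrite i'E => me; apply/ipK; exists m.
Qed.

Lemma restrict_cosyzygy (M : lmodType R) d C :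
  restriction_preserves_injectives ->
  cosyzygy M d C -> cosyzygy (restrict psi M) d (restrict psi C).
Proof.
move=> flat; elim=> [|{}d {}C E C' i p _ CX Einj ip]; first exact: Cosyzygy0.
have [i' [p' ip']] := restrict_short_exact ip.
exact: CosyzygyS CX (flat _ Einj) ip'.
Qed.

Lemma coind_short_exact (M : lmodType R) :
  short_exact (@coind_unit _ _ psi M) (@cosyz_proj _ _ psi M).
Proof.
split.
- exact: coind_unit_inj.
- by move=> c; exists (cosyz_val c); exact: cosyz_valK.
- move=> e; split=> [/cosyz_proj_ker ->|[m <-]]; first by exists (e 1).
  exact: cosyz_proj_unit.
Qed.

End ChangeOfRings.

(** * Change of rings *)

Section Field.
Variable K : fieldType.

Lemma field_module_injective (E : lmodType K) : injective_module E.
Proof.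
apply: baer_injective => I g [I0 ID IM] gD gM.
have [[x Ix x0]|no] := pselect (exists2 x, I x & x != 0).
  exists (x^-1 *: g x) => y Iy.
  by rewrite scalerA -gM// -mulrA mulVf// mulr1.
exists 0 => x Ix; have /eqP -> : x == 0.
  by apply: contrapT => /negP x0; apply: no; exists x.
by rewrite -[X in g X](mul0r 0) gM// !scale0r.
Qed.

Lemma enough_injectives_algebra (R : comNzRingType) (psi : {rmorphism K -> R}) :
  enough_injectives R.
Proof.
move=> M; exists (coind psi M), (cosyz psi M).
exists (@coind_unit _ _ psi M), (@cosyz_proj _ _ psi M).
split; last exact: coind_short_exact.
by apply: coind_injective; exact: field_module_injective.
Qed.

End Field.

Section PolynomialExtension.
Variable A : comNzRingType.

(** An ideal [I] of [A] extends to the ideal [J] of the polynomials with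
coefficients in [I], and a map [g] on [I] to the map [G] on [J] that is
determined by [G (a X^i) = X^i g(a)]. *)
Lemma poly_restrict_injective :
  restriction_preserves_injectives (@polyC A : {rmorphism A -> {poly A}}).
Proof.
move=> E /injective_extends_from_ideals Einj.
apply: baer_injective => I g idI gD gM; have [I0 ID IM] := idI.
have g0 : g 0 = 0 by rewrite -[X in g X](mul0r 0) gM// scale0r.
pose J := [set p : {poly A} | forall i, I p`_i].
pose G (p : {poly A}) : E := \sum_(i < size p) 'X^i *: (g p`_i : E).
have GE (p : {poly A}) n : (size p <= n)%N ->
    G p = \sum_(i < n) 'X^i *: (g p`_i : E).
  move=> pn; rewrite /G (big_ord_widen n (fun i => 'X^i *: (g p`_i : E)) pn).
  rewrite big_mkcond; apply: eq_bigr => i _.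
  by case: ltnP => // ip; rewrite nth_default// g0 scaler0.
have JD p q : J p -> J q -> J (p + q) by move=> Jp Jq i; rewrite coefD; apply: ID.
have JC c p : J p -> J (c%:P * p) by move=> Jp i; rewrite coefCM; apply: IM.
have JX p : J p -> J ('X * p) by move=> Jp i; rewrite coefXM; case: eqP.
have J0 : J 0 by move=> i; rewrite coef0.
have JM q p : J p -> J (q * p).
  elim/poly_ind: q p => [|q c IHq] p Jp; first by rewrite mul0r.
  by rewrite mulrDl; apply: JD; [rewrite -mulrA; apply/IHq/JX | exact: JC].
have GD p q : J p -> J q -> G (p + q) = G p + G q.
  move=> Jp Jq; pose n := maxn (size p) (size q).
  rewrite !(GE _ n) ?leq_maxl ?leq_maxr//; last exact: size_polyD.
  rewrite -big_split; apply: eq_bigr => i _ /=.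
  by rewrite coefD gD// scalerDr.
have GC c p : J p -> G (c%:P * p) = c%:P *: G p.
  move=> Jp; rewrite (GE _ (size p)); last by rewrite mul_polyC size_scale_leq.
  rewrite scaler_sumr; apply: eq_bigr => i _.
  by rewrite coefCM gM// restrict_scaleE !scalerA mulrC.
have GX p : J p -> G ('X * p) = 'X *: G p.
  move=> Jp; rewrite (GE _ (size p).+1); last first.
    by rewrite mulrC (leq_trans (size_polyMleq _ _))// size_polyX addn2.
  rewrite big_ord_recl coefXM /= g0 scaler0 add0r scaler_sumr.
  by apply: eq_bigr => i _; rewrite coefXM /= scalerA -exprS.
have GM q p : J p -> G (q * p) = q *: G p.
  elim/poly_ind: q p => [|q c IHq] p Jp.
    by rewrite mul0r scale0r /G size_poly0 big_ord0.
  rewrite mulrDl -mulrA GD; [|exact/JM/JX|exact: JC].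
  by rewrite IHq ?GX ?GC ?scalerDl ?scalerA//; exact: JX.
have [|e eP] := Einj J G _ GD GM; first by split.
exists e => x Ix; rewrite restrict_scaleE -eP.
  by rewrite (GE _ 1%N) ?size_polyC_leq1// big_ord1 coefC scale1r.
by move=> i; rewrite coefC; case: eqP.
Qed.

(** An [A]-linear function [f] on [A[X]] is [A[X]]-linear, that is, in the range
of [coind_unit], if and only if it commutes with [X]; this identifies the
kernel of [f |-> f(X r) - X f(r)]. The map is surjective because the values of a
preimage at the powers of [X] can be chosen recursively. *)
Lemma poly_coind_short_exact (M : lmodType {poly A}) :
  let Co := coind (@polyC A : {rmorphism A -> {poly A}}) M in
  exists (i : {linear M -> Co}) (p : {linear Co -> Co}), short_exact i p.
Proof.
set psi : {rmorphism A -> {poly A}} := @polyC A.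
move=> Co.
have Dex (f : Co) : exists g : Co, forall x, g x = f ('X * x) - 'X *: f x.
  apply: coind_exists => a x y.
  rewrite mulrDr mulrCA !coindP scalerDr scalerBr opprD addrACA.
  by congr (_ - _ + _); rewrite !scalerA mulrC.
pose D f := projT1 (cid (Dex f)).
have DE f x : D f x = f ('X * x) - 'X *: f x by rewrite /D; case: cid.
have Dlin : linear D.
  move=> r f g; apply: coind_eq => x.
  rewrite coindDE coind_scaleE !DE !coindDE !coind_scaleE mulrA.
  by rewrite scalerDr opprD addrACA.
have [p pE] := linear_exists Dlin.
exists (@coind_unit _ _ psi M), p; split.
- exact: coind_unit_inj.
- move=> g.
  (* The equation f(X r) - X f(r) = g(r) at r = X^j determines the value s of
     f at X^(j+1) from its value at X^j; the value at 1 is arbitrary. *)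
  pose s := fix s i : M := if i is j.+1 then 'X *: s j + g 'X^j else 0.
  pose F (q : {poly A}) : M := \sum_(i < size q) psi q`_i *: s i.
  have FE (q : {poly A}) n : (size q <= n)%N -> F q = \sum_(i < n) psi q`_i *: s i.
    move=> qn; rewrite /F (big_ord_widen n (fun i => psi q`_i *: s i) qn).
    rewrite big_mkcond; apply: eq_bigr => i _.
    by case: ltnP => // iq; rewrite nth_default// rmorph0 scale0r.
  have [f fE] : exists f : Co, forall x, f x = F x.
    apply: coind_exists => a x y.
    pose n := maxn (size x) (size y).
    have h1 : (size (psi a * x + y)%R <= n)%N.
      rewrite (leq_trans (size_polyD _ _))// /n geq_max leq_maxr andbT.
      by rewrite mul_polyC (leq_trans (size_scale_leq _ _))// leq_maxl.
    rewrite (FE _ n h1) (FE x n) ?leq_maxl// (FE y n) ?leq_maxr//.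
    rewrite scaler_sumr -big_split; apply: eq_bigr => i _ /=.
    by rewrite coefD coefCM rmorphD rmorphM scalerDl scalerA.
  exists f; apply: coind_eq => q.
  rewrite pE DE !fE (FE ('X * q) (size q).+1); last first.
    by rewrite mulrC (leq_trans (size_polyMleq _ _))// size_polyX addn2.
  rewrite big_ord_recl scaler0 add0r /F scaler_sumr -sumrB.
  rewrite -[q in RHS]coefK poly_def.
  have gsum n (h : 'I_n -> {poly A}) : g (\sum_(i < n) h i) = \sum_(i < n) g (h i).
    by elim/big_ind2: _ => [|x u y v <- <-|]//; [exact: coind0 | rewrite coindD].
  rewrite gsum; apply: eq_bigr => i _.
  rewrite coefXM /= scalerDr !scalerA [_ * 'X]mulrC addrAC subrr add0r.
  by rewrite -coindZ -mul_polyC.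
- move=> f; rewrite pE; split.
    move=> f0; exists (f 1); apply: coind_eq => q; rewrite coind_unitE.
    have fX x : f ('X * x) = 'X *: f x.
      by apply/eqP; rewrite -subr_eq0 -DE f0.
    elim/poly_ind: q => [|q c IHq]; first by rewrite scale0r coind0.
    have fC : f c%:P = c%:P *: f 1 by rewrite -{1}[c%:P]mulr1; exact: coindZ.
    by rewrite coindD mulrC fX -IHq fC scalerDl scalerA.
  move=> [m <-]; apply: coind_eq => x.
  by rewrite DE !coind_unitE scalerA subrr.
Qed.

(** The inductive step of Hilbert's syzygy theorem, on the injective side. *)
Lemma poly_cosyzygies_injective d :
  cosyzygies_injective A d -> cosyzygies_injective {poly A} d.+1.
Proof.
move=> Ad M X MX; inversion_clear MX as [|? C E ? i p MC Einj ip].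
have Cinj := Ad _ _ (restrict_cosyzygy poly_restrict_injective MC).
have [i' [p' ip']] := poly_coind_short_exact C.
have Coinj := coind_injective Cinj.
exact: (cokernel_injective ip' ip Coinj Coinj Einj).
Qed.

End PolynomialExtension.

Section LocalizationExtension.
Variables (S L : comNzRingType) (m : set S) (phi : {rmorphism S -> L}).
Hypothesis m1 : ~ m 1.
Hypothesis mM : forall s t, ~ m s -> ~ m t -> ~ m (s * t).
Hypothesis locL : is_localization m phi.

Lemma localization_scale_inj (M : lmodType L) s (x y : M) :
  ~ m s -> phi s *: x = phi s *: y -> x = y.
Proof.
case: locL => unit _ _ /unit[z sz] xy.
by rewrite -[x]scale1r -[y]scale1r -sz mulrC -!scalerA xy.
Qed.

(** An ideal [I] of [S] extends to the ideal [J] of the fractions [a / s] with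
numerator in [I], and a map [g] on [I] to the map [a / s |-> g(a) / s]. The
relation [G] is the graph of the latter. *)
Lemma localization_restrict_injective : restriction_preserves_injectives phi.
Proof.
move=> E /injective_extends_from_ideals Einj.
apply: baer_injective => I g idI gD gM; have [I0 ID IM] := idI.
have [unit frac ker] := locL.
have {}gM a x : I x -> g (a * x) = phi a *: (g x : E) by move/gM->.
pose G l (e : E) := exists a s,
  [/\ I a, ~ m s, l * phi s = phi a & phi s *: e = g a].
pose J := [set l | exists a s, [/\ I a, ~ m s & l * phi s = phi a]].
have Guniq l e e' : G l e -> G l e' -> e = e'.
  move=> [a [s [Ia ms la ea]]] [a' [s' [Ia' ms' la' ea']]].
  have [|u mu uE] := ker (a * s' - a' * s).
    by rewrite rmorphB !rmorphM -la -la' mulrAC subrr.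
  have uE' : u * s' * a = u * s * a'.
    by apply/eqP; rewrite -subr_eq0 -!mulrA -mulrBr [s' * a]mulrC [s * a']mulrC uE.
  apply: (@localization_scale_inj _ (u * s * s')); first exact/mM/ms'/mM.
  have -> : phi (u * s * s') *: e = g (u * s' * a).
    by rewrite mulrAC rmorphM -scalerA ea gM.
  by rewrite rmorphM -scalerA ea' -gM// -uE'.
have GJ l : J l -> exists e, G l e.
  move=> [a [s [Ia ms la]]]; have [z sz] := unit _ ms.
  by exists (z *: (g a : E)), a, s; split=> //; rewrite scalerA sz scale1r.
pose g' l := xget 0 [set e | G l e].
have g'E l e : G l e -> g' l = e.
  by move=> Gle; apply: xget_unique => // e' /Guniq; apply.
have GD l l' e e' : G l e -> G l' e' -> G (l + l') (e + e').
  move=> [a [s [Ia ms la ea]]] [a' [s' [Ia' ms' la' ea']]].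
  exists (s' * a + s * a'), (s * s'); split.
  - by apply: ID; exact: IM.
  - exact: mM.
  - by rewrite rmorphM rmorphD !rmorphM -la -la'; ring.
  - rewrite gD ?gM//; [|exact: IM|exact: IM].
    by rewrite rmorphM scalerDr -ea -ea' !scalerA mulrC.
have GM x l e : G l e -> G (x * l) (x *: e).
  move=> [a [s [Ia ms la ea]]]; have [b [t [mt xt]]] := frac x.
  exists (b * a), (s * t); split.
  - exact: IM.
  - exact: mM.
  - by rewrite !rmorphM -la -xt [phi s * _]mulrC mulrACA.
  - by rewrite gM// rmorphM -ea !scalerA -xt; congr (_ *: _); ring.
have [|||e eP] := Einj J g'.
- split.
  + by exists 0, 1; split=> //; rewrite mul0r rmorph0.
  + move=> x y /GJ[e xe] /GJ[e' ye].
    by have [a [s [? ? ? _]]] := GD _ _ _ _ xe ye; exists a, s.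
  + by move=> a x /GJ[e xe]; have [b [s [? ? ? _]]] := GM a _ _ xe; exists b, s.
- move=> x y /GJ[e xe] /GJ[e' ye].
  by rewrite (g'E _ _ xe) (g'E _ _ ye); exact/g'E/GD.
- by move=> a x /GJ[e xe]; rewrite (g'E _ _ xe); exact/g'E/GM.
exists e => x Ix; rewrite restrict_scaleE -eP; last first.
  by exists x, 1; split=> //; rewrite rmorph1 mulr1.
by apply/esym/g'E; exists x, 1; rewrite rmorph1 mulr1 scale1r.
Qed.

(** [S]-linear maps between [L]-modules are [L]-linear, because the elements
outside [m] act injectively on [L]-modules. *)
Lemma localization_restrict_full (M : lmodType L) :
  injective_module (restrict phi M) -> injective_module M.
Proof.
move=> Minj U V f g f_inj.
have [f' f'E] := restrict_linear phi f; have [g' g'E] := restrict_linear phi g.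
have [|h hP] := Minj _ _ f' g'; first by move=> x y; rewrite !f'E => /f_inj.
have [_ frac _] := locL.
have hZ (s : S) (v : V) : h (phi s *: v : V) = phi s *: (h v : M).
  exact: (linearZZ h s v).
have lin : linear (h : V -> M).
  move=> l u v; rewrite linearD; congr (_ + _).
  have [a [s [ms ls]]] := frac l.
  apply: (localization_scale_inj ms).
  by rewrite -hZ !scalerA mulrC ls -hZ.
have [k kE] := linear_exists lin.
by exists k => a; rewrite kE -f'E hP g'E.
Qed.

Lemma localization_cosyzygies_injective d :
  cosyzygies_injective S d -> cosyzygies_injective L d.
Proof.
move=> Sd M C MC; apply: localization_restrict_full; apply: (Sd (restrict phi M)).
exact: restrict_cosyzygy localization_restrict_injective MC.
Qed.

End LocalizationExtension.

(** * Ideals and Hilbert's basis theorem *)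

Section IdealGen.
Variable R : comNzRingType.
Implicit Types (A B I : set R).

Lemma ideal_gen_ideal A : is_ideal (ideal_gen A).
Proof.
split.
- by exists [::]; rewrite ?big_nil.
- move=> _ _ [s sA ->] [t tA ->]; exists (s ++ t); last by rewrite big_cat.
  by move=> u; rewrite mem_cat => /orP[/sA|/tA].
- move=> a _ [s sA ->]; exists [seq (a * u.1, u.2) | u <- s].
    by move=> _ /mapP[u us ->] /=; exact: sA.
  by rewrite big_map mulr_sumr; apply: eq_bigr => u _; rewrite mulrA.
Qed.

Lemma sub_ideal_gen A : A `<=` ideal_gen A.
Proof.
move=> a Aa; exists [:: (1, a)]; last by rewrite big_seq1 mul1r.
by move=> u; rewrite inE => /eqP ->.
Qed.

Lemma ideal_sum I (T : eqType) (s : seq T) (F : T -> R) :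
  is_ideal I -> (forall u, u \in s -> I (F u)) -> I (\sum_(u <- s) F u).
Proof.
by move=> [I0 ID _] IF; rewrite big_seq; exact: big_ind.
Qed.

Lemma ideal_gen_min A I : is_ideal I -> A `<=` I -> ideal_gen A `<=` I.
Proof.
move=> idI AI _ [s sA ->]; apply: ideal_sum => // u us.
by have [_ _ IM] := idI; apply/IM/AI/sA.
Qed.

Lemma ideal_gen_le A B : A `<=` ideal_gen B -> ideal_gen A `<=` ideal_gen B.
Proof. by apply: ideal_gen_min; exact: ideal_gen_ideal. Qed.

Lemma idealB I x y : is_ideal I -> I x -> I y -> I (x - y).
Proof. by move=> [_ ID IM] Ix Iy; apply: ID => //; rewrite -mulN1r; exact: IM. Qed.

Lemma maximal_ideal_prime (m : set R) : maximal_ideal m ->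
  forall s t, ~ m s -> ~ m t -> ~ m (s * t).
Proof.
move=> [idm m1 mmax] s t ms mt mst; have [m0 mD mM] := idm.
pose I := [set x | exists y r, m y /\ x = y + r * s].
have idI : is_ideal I.
  split.
  - by exists 0, 0; rewrite mul0r addr0.
  - move=> _ _ [y [r [my ->]]] [z [q [mz ->]]]; exists (y + z), (r + q).
    by split; [exact: mD | ring].
  - move=> a _ [y [r [my ->]]]; exists (a * y), (a * r).
    by split; [exact: mM | ring].
have [[y [r [my yE]]]|I1] := pselect (I 1).
  apply: mt; have -> : t = t * y + r * (s * t) by rewrite -[LHS]mulr1 yE; ring.
  by apply: mD; exact: mM.
apply: ms; rewrite -(mmax I idI I1); last first.
  by move=> x mx; exists x, 0; rewrite mul0r addr0.
by exists 0, 1; rewrite add0r mul1r.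
Qed.

End IdealGen.

Section HilbertBasis.
Variable A : comNzRingType.

Definition leading_ideal (I : set {poly A}) n : set A :=
  [set a | exists p : {poly A}, [/\ I p, (size p <= n.+1)%N & p`_n = a]].

Lemma leading_ideal_ideal I n : is_ideal I -> is_ideal (leading_ideal I n).
Proof.
move=> [I0 ID IM]; split.
- by exists 0; rewrite size_poly0 coef0.
- move=> _ _ [p [Ip sp <-]] [q [Iq sq <-]]; exists (p + q); split.
  + exact: ID.
  + by rewrite (leq_trans (size_polyD _ _))// geq_max sp sq.
  + by rewrite coefD.
- move=> a _ [p [Ip sp <-]]; exists (a%:P * p); split.
  + exact: IM.
  + by rewrite mul_polyC (leq_trans (size_scale_leq _ _)).
  + by rewrite coefCM.
Qed.

(** The same combination of lifts of the generators realizes any combination of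
leading coefficients, without raising the degree. *)
Lemma leading_ideal_lift I n (s : seq A) : is_ideal I ->
  (forall a, a \in s -> leading_ideal I n a) ->
  exists t : seq {poly A}, (forall p, p \in t -> I p) /\
    forall a, ideal_gen [set` s] a -> exists q,
      [/\ ideal_gen [set` t] q, (size q <= n.+1)%N & q`_n = a].
Proof.
move=> idI sJ.
have ex a : exists p : {poly A}, a \in s -> [/\ I p, (size p <= n.+1)%N & p`_n = a].
  have [as_|_] := boolP (a \in s); last by exists 0.
  by have [p pP] := sJ _ as_; exists p.
pose lift a := projT1 (cid (ex a)).
have liftP a : a \in s ->
    [/\ I (lift a), (size (lift a) <= n.+1)%N & (lift a)`_n = a].
  by rewrite /lift; case: cid.
exists [seq lift a | a <- s]; split.
  by move=> _ /mapP[a as_ ->]; have [] := liftP _ as_.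
move=> _ [v vs ->]; exists (\sum_(u <- v) u.1%:P * lift u.2).
have [g0 gD gM] := ideal_gen_ideal [set` [seq lift a | a <- s]].
split.
- apply: ideal_sum; first exact: ideal_gen_ideal.
  by move=> u /vs us; apply/gM/sub_ideal_gen/map_f.
- rewrite big_seq; elim/big_ind: _ => [|p q sp sq|u /vs /liftP[_ su _]].
  + by rewrite size_poly0.
  + by rewrite (leq_trans (size_polyD _ _))// geq_max sp sq.
  + by rewrite mul_polyC (leq_trans (size_scale_leq _ _)).
- rewrite coef_sum big_seq [RHS]big_seq; apply: eq_bigr => u /vs /liftP[_ _ uE].
  by rewrite coefCM uE.
Qed.

Lemma leading_ideal_chain I n k : is_ideal I ->
  leading_ideal I n `<=` leading_ideal I (n + k).
Proof.
move=> [_ _ IM] a [p [Ip sp <-]]; exists ('X^k * p); split; first exact: IM.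
  by rewrite (leq_trans (size_polyMleq _ _))// size_polyXn; lia.
by rewrite coefXnM ltnNge leq_addl addnK.
Qed.

(** The leading ideals form an increasing chain whose union is finitely
generated, so the chain is constant from some index [N] on. Polynomials of [I]
lifting generators of the leading ideals up to index [N] generate [I], by
induction on the size: they suffice to cancel any leading coefficient. *)
Lemma hilbert_basis : noetherian A -> noetherian {poly A}.
Proof.
move=> noethA I idI; have [I0 ID IM] := idI.
pose J n := leading_ideal I n; pose Jw := [set a | exists n, J n a].
have idJ n : is_ideal (J n) by exact: leading_ideal_ideal.
have Jmon n n' : (n <= n')%N -> J n `<=` J n'.
  by move=> /subnKC <-; exact: leading_ideal_chain.
have idJw : is_ideal Jw.
  split.
  - by exists 0; have [] := idJ 0%N.
  - move=> x y [n xn] [n' yn']; exists (maxn n n').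
    have [_ JD _] := idJ (maxn n n').
    apply: JD; first by apply: Jmon xn; exact: leq_maxl.
    by apply: Jmon yn'; exact: leq_maxr.
  - by move=> a x [n xn]; exists n; have [_ _ JM] := idJ n; exact: JM.
have [s sE] := noethA _ idJw.
have [N sN] : exists N, forall a, a \in s -> J N a.
  have : forall a, a \in s -> Jw a.
    by move=> a as_; rewrite sE; exact: sub_ideal_gen.
  elim: s {sE} => [|a s IHs] sJ; first by exists 0%N.
  have [|N NP] := IHs; first by move=> b bs; apply: sJ; rewrite inE bs orbT.
  have [n na] := sJ a (mem_head _ _).
  exists (maxn n N) => b; rewrite inE => /orP[/eqP ->|/NP bN].
    by apply: Jmon na; exact: leq_maxl.
  by apply: Jmon bN; exact: leq_maxr.
have JN n : J n `<=` J N.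
  move=> a an; have : Jw a by exists n.
  by rewrite sE; apply: ideal_gen_min; first exact: idJ.
have tex n : exists t : seq {poly A}, (forall p, p \in t -> I p) /\
    forall a, J n a -> exists q,
      [/\ ideal_gen [set` t] q, (size q <= n.+1)%N & q`_n = a].
  have [s' s'E] := noethA _ (idJ n).
  have [|t [tI tP]] := @leading_ideal_lift I n s' idI.
    by move=> a as'; rewrite -/(J n) s'E; exact: sub_ideal_gen.
  by exists t; split=> // a; rewrite s'E => /tP.
pose t n := projT1 (cid (tex n)).
have tI n p : p \in t n -> I p by rewrite /t; case: cid => /= t' [+ _]; apply.
have tP n a : J n a -> exists q,
    [/\ ideal_gen [set` t n] q, (size q <= n.+1)%N & q`_n = a].
  by rewrite /t; case: cid => /= t' [_]; apply.
pose T := flatten [seq t n | n <- iota 0 N.+1].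
have TI p : p \in T -> I p by move=> /flatten_mapP[n _ /tI].
have idT : is_ideal (ideal_gen [set` T]) := ideal_gen_ideal _.
have [T0 TD TM] := idT.
have tT n : (n <= N)%N -> ideal_gen [set` t n] `<=` ideal_gen [set` T].
  move=> nN; apply: ideal_gen_le => p /= pt; apply: sub_ideal_gen => /=.
  by apply/flatten_mapP; exists n => //; rewrite mem_iota.
have lead p : I p -> exists q : {poly A},
    [/\ ideal_gen [set` T] q, (size q <= size p)%N
      & q`_(size p).-1 = p`_(size p).-1].
  move=> Ip; have [->|p0] := eqVneq p 0; first by exists 0.
  have := size_poly_gt0 p; rewrite p0; case sp: (size p) => [//|n] _ /=.
  have pn : J n p`_n by exists p; rewrite sp.
  have [nN|Nn] := leqP n N.
    by have [q [qt sq qE]] := tP _ _ pn; exists q; split=> //; exact: tT qt.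
  have [q [qt sq qE]] := tP _ _ (JN _ _ pn); exists ('X^(n - N) * q); split.
  - exact/TM/(tT N).
  - by rewrite (leq_trans (size_polyMleq _ _))// size_polyXn; lia.
  - by rewrite coefXnM ltnNge leq_subr /= subKn// ltnW.
exists T; rewrite eqEsubset; split; last by apply: ideal_gen_min => // p /TI.
move=> p; have [n] := ubnP (size p); elim: n p => // n IHn p pn Ip.
have [->//|p0] := eqVneq p 0.
have [q [Tq sq qE]] := lead p Ip.
rewrite -[p](subrK q); apply: TD => //; apply: IHn; last first.
  by apply: idealB => //; apply: ideal_gen_min Tq => // r /TI.
have sp : (0 < size p)%N by rewrite size_poly_gt0.
rewrite ltnS in pn; apply: leq_trans pn; rewrite -[size p]prednK// ltnS.
apply/leq_sizeP => j; rewrite leq_eqVlt => /orP[/eqP <-|].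
  by rewrite coefB qE subrr.
rewrite prednK// => pj; rewrite coefB !nth_default ?subrr//.
exact: leq_trans pj.
Qed.

End HilbertBasis.

Lemma field_noetherian (K : fieldType) : noetherian K.
Proof.
move=> I idI; have [I0 ID IM] := idI.
have [[x Ix x0]|no] := pselect (exists2 x, I x & x != 0).
  exists [:: 1]; rewrite eqEsubset; split.
    move=> y _; exists [:: (y, 1)]; last by rewrite big_seq1 mulr1.
    by move=> u; rewrite inE => /eqP -> /=; rewrite inE.
  by move=> y _; rewrite -[y](mulfVK x0); exact: IM.
exists [::]; rewrite eqEsubset; split; last by apply: ideal_gen_min.
move=> y Iy; have /eqP -> : y == 0.
  by apply: contrapT => /negP y0; apply: no; exists y.
by have [] := ideal_gen_ideal [set` ([::] : seq K)].
Qed.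

(** * Polynomial rings over a field are Gorenstein *)

Section Localization.
Variable S : idomainType.

(** Bundled because the ring structure of [localization] has to be inferred from
its argument alone. *)
Record prime_subset := PrimeSubset {
  prime_set : set S;
  prime_set0 : prime_set 0;
  prime_set1 : ~ prime_set 1;
  prime_setM : forall s t, ~ prime_set s -> ~ prime_set t -> ~ prime_set (s * t) }.

Variable P : prime_subset.

Lemma prime_denom_neq0 s : ~ prime_set P s -> (tofrac s) != 0.
Proof.
move=> Ps; apply/eqP => /eqP; rewrite tofrac_eq0 => /eqP s0.
by apply: Ps; rewrite s0; exact: prime_set0.
Qed.

(** For a domain the localization is a subring of the field of fractions. *)
Definition localization_pred : {pred {fraction S}} := fun q =>
  `[< exists a s, ~ prime_set P s /\ q * tofrac s = tofrac a >].

Lemma localization_subring_closed : GRing.subring_closed localization_pred.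
Proof.
split.
- by apply/asboolP; exists 1, 1; split; [exact: prime_set1 | rewrite mul1r].
- move=> x y /asboolP[a [s [Ps xs]]] /asboolP[b [t [Pt yt]]]; apply/asboolP.
  exists (a * t - b * s), (s * t); split; first exact: prime_setM.
  by rewrite tofracB !tofracM -xs -yt; ring.
- move=> x y /asboolP[a [s [Ps xs]]] /asboolP[b [t [Pt yt]]]; apply/asboolP.
  exists (a * b), (s * t); split; first exact: prime_setM.
  by rewrite !tofracM -xs -yt; ring.
Qed.
HB.instance Definition _ := GRing.isSubringClosed.Build {fraction S}
  localization_pred localization_subring_closed.

Record localization : Type := Localization {
  localization_val :> {fraction S};
  localization_valP : localization_val \in localization_pred }.
HB.instance Definition _ := [isSub for localization_val].
HB.instance Definition _ := [Choice of localization by <:].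
HB.instance Definition _ := [SubChoice_isSubComNzRing of localization by <:].

Fact to_localization_subproof a : tofrac a \in localization_pred.
Proof.
by apply/asboolP; exists a, 1; split; [exact: prime_set1 | rewrite tofrac1 mulr1].
Qed.
Definition to_localization a := Localization (to_localization_subproof a).
Fact to_localization_zmod : zmod_morphism to_localization.
Proof. by move=> a b; apply: val_inj; rewrite /= tofracB. Qed.
Fact to_localization_monoid : monoid_morphism to_localization.
Proof. by split=> [|a b]; apply: val_inj; rewrite /= ?tofrac1 ?tofracM. Qed.
HB.instance Definition _ := GRing.isZmodMorphism.Build S localization
  to_localization to_localization_zmod.
HB.instance Definition _ := GRing.isMonoidMorphism.Build S localization
  to_localization to_localization_monoid.

Lemma localizationP : is_localization (prime_set P) to_localization.
Proof.
split.
- move=> s Ps; have s0 := prime_denom_neq0 Ps.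
  have sV : (tofrac s)^-1 \in localization_pred.
    by apply/asboolP; exists 1, s; split=> //; rewrite mulVf// tofrac1.
  by exists (Localization sV); apply: val_inj => /=; rewrite divff.
- move=> x; have /asboolP[a [s [Ps xs]]] := localization_valP x.
  by exists a, s; split=> //; apply: val_inj.
- move=> a /(congr1 localization_val) /= /eqP; rewrite tofrac_eq0 => /eqP ->.
  by exists 1; [exact: prime_set1 | rewrite mulr0].
Qed.

End Localization.

Lemma gorenstein_domain (K : fieldType) (S : idomainType)
    (psi : {rmorphism K -> S}) d :
  noetherian S -> cosyzygies_injective S d -> gorenstein S.
Proof.
move=> noethS Sd; split=> // m maxm.
have mM := maximal_ideal_prime maxm; have [[m0 _ _] m1 _] := maxm.
pose P := PrimeSubset m0 m1 mM; have locP := localizationP P.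
exists (localization P), (@to_localization S P); split=> //.
exists d; apply: injdim_le_cosyzygies => [|C].
  exact: (enough_injectives_algebra (@to_localization S P \o psi)).
exact: (localization_cosyzygies_injective m1 mM locP Sd).
Qed.

(** [K[X_1,...,X_n]] as an iterated univariate polynomial ring, the form in which
the basis theorem and the syzygy theorem apply to it by induction. *)
Fixpoint poly_tower (K : fieldType) n : idomainType :=
  if n is n'.+1 then {poly poly_tower K n'} else K.

Fixpoint tower_const (K : fieldType) n : {rmorphism K -> poly_tower K n} :=
  match n return {rmorphism K -> poly_tower K n} with
  | 0 => (idfun : {rmorphism K -> K})
  | n'.+1 => (polyC \o tower_const K n' : {rmorphism K -> {poly poly_tower K n'}})
  end.

Lemma poly_tower_noetherian K n : noetherian (poly_tower K n).
Proof.
by elim: n => [|n IHn]; [exact: field_noetherian | exact: hilbert_basis].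
Qed.

Lemma poly_tower_cosyzygies K n : cosyzygies_injective (poly_tower K n) n.
Proof.
elim: n => [|n IHn]; last exact: poly_cosyzygies_injective.
by move=> M C _; exact: field_module_injective.
Qed.

Lemma gorenstein_poly_tower K n : gorenstein (poly_tower K n).
Proof.
apply: (@gorenstein_domain K (poly_tower K n) (tower_const K n) n).
  exact: poly_tower_noetherian.
exact: poly_tower_cosyzygies.
Qed.

Section Isomorphism.
Variables (R R' : comNzRingType) (f : {rmorphism R -> R'}).
Hypotheses (f_inj : injective f) (f_surj : forall y, exists x, f x = y).

Lemma preimage_ideal (I : set R') : is_ideal I -> is_ideal (f @^-1` I).
Proof.
move=> [I0 ID IM]; split.
- by rewrite /preimage /= rmorph0.
- by move=> x y Ix Iy; rewrite /preimage /= rmorphD; exact: ID.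
- by move=> a x Ix; rewrite /preimage /= rmorphM; exact: IM.
Qed.

Lemma image_ideal (I : set R) : is_ideal I -> is_ideal (f @` I).
Proof.
move=> [I0 ID IM]; split.
- by exists 0 => //; rewrite rmorph0.
- by move=> _ _ [x Ix <-] [y Iy <-]; exists (x + y); [exact: ID | rewrite rmorphD].
- move=> b _ [x Ix <-]; have [a <-] := f_surj b.
  by exists (a * x); [exact: IM | rewrite rmorphM].
Qed.

Lemma gorenstein_iso : gorenstein R -> gorenstein R'.
Proof.
move=> [noethR gorR]; split.
  move=> I idI; have [s sE] := noethR _ (preimage_ideal idI).
  exists [seq f x | x <- s]; rewrite eqEsubset; split.
    move=> y; have [x <-] := f_surj y => Ix.
    have : ideal_gen [set` s] x by rewrite -sE.
    apply: (ideal_gen_min (I := f @^-1` ideal_gen [set` [seq f x | x <- s]])).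
      exact/preimage_ideal/ideal_gen_ideal.
    by move=> z zs; apply: sub_ideal_gen; apply: map_f.
  apply: ideal_gen_min => // _ /mapP[x xs ->].
  by have /= : (f @^-1` I) x by rewrite sE; exact: sub_ideal_gen.
move=> m [idm m1 mmax].
have [|L [phi [[unit frac ker] injd]]] := gorR (f @^-1` m).
  split; first exact: preimage_ideal.
    by rewrite /preimage /= rmorph1.
  move=> I idI I1 mI.
  have fI : f @` I = m.
    apply: mmax; first exact: image_ideal.
      by move=> [x Ix]; rewrite -(rmorph1 f) => /f_inj x1; rewrite x1 in Ix.
    move=> y my; have [x xy] := f_surj y; exists x => //.
    by apply: mI; rewrite /preimage /= xy.
  rewrite -fI eqEsubset; split; first by move=> x Ix; exists x.
  by move=> x [y Iy /f_inj <-].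
pose g y := projT1 (cid (f_surj y)).
have gK y : f (g y) = y by rewrite /g; case: cid.
have gf x : g (f x) = x by apply: f_inj; rewrite gK.
have psiZ : zmod_morphism (phi \o g).
  move=> x y; rewrite /= -rmorphB; congr (phi _).
  by apply: f_inj; rewrite rmorphB !gK.
have psiM : monoid_morphism (phi \o g).
  split=> [|x y]; rewrite /= -1?(rmorph1 phi) -?rmorphM;
    congr (phi _); apply: f_inj.
    by rewrite gK rmorph1.
  by rewrite rmorphM !gK.
pose aZ := GRing.isZmodMorphism.Build _ _ _ psiZ.
pose aM := GRing.isMonoidMorphism.Build _ _ _ psiM.
pose psi : {rmorphism R' -> L} := HB.pack (phi \o g) aZ aM.
exists L, psi; split=> //; split.
- by move=> s ms; apply: unit; rewrite /preimage /= gK.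
- move=> x; have [a [s [ms xs]]] := frac x.
  by exists (f a), (f s); split=> //=; rewrite !gf.
- move=> a /ker[s ms sa]; exists (f s) => //.
  by rewrite -[a]gK -rmorphM sa rmorph0.
Qed.

End Isomorphism.

(** * Algebras generated by independent monomials *)

Section MonomialAlgebra.
Variables (K : fieldType) (n : nat) (v : nat -> 'X_{1..n}).
Local Notation S := {mpoly K[n]}.

Fact tower_eval_comm (R : comNzRingType) (f : {rmorphism R -> S}) (w : S) :
  commr_rmorph f w.
Proof. by move=> x; exact: mulrC. Qed.

Fixpoint tower_eval k : {rmorphism poly_tower K k -> S} :=
  match k return {rmorphism poly_tower K k -> S} with
  | 0 => (@mpolyC n K : {rmorphism K -> S})
  | k'.+1 => (horner_morph (tower_eval_comm (tower_eval k') 'X_[v k'])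
              : {rmorphism {poly poly_tower K k'} -> S})
  end.

Lemma tower_evalS k (p : {poly poly_tower K k}) :
  tower_eval k.+1 p = \sum_(i < size p) tower_eval k p`_i * 'X_[v k] ^+ i.
Proof.
rewrite /= /horner_morph (horner_coef_wide _ (size_poly _ _)).
by apply: eq_bigr => i _; rewrite coef_map.
Qed.

Lemma tower_evalX k : tower_eval k.+1 'X = 'X_[v k].
Proof. exact: horner_morphX. Qed.
Lemma tower_evalC k c : tower_eval k.+1 c%:P = tower_eval k c.
Proof. exact: horner_morphC. Qed.

Lemma tower_eval_const k c : tower_eval k (tower_const K k c) = c%:MP.
Proof. by elim: k => [|k IHk] //; rewrite -IHk; exact: tower_evalC. Qed.

Definition exponent k (a : nat -> nat) : 'X_{1..n} := (\sum_(i < k) v i *+ a i)%MM.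

(** Distinct monomials in the [v i] have distinct exponents, which is algebraic
independence of the monomials ['X_[v i]]. *)
Definition independent k : Prop := forall a b : nat -> nat,
  exponent k a = exponent k b -> forall i, (i < k)%N -> a i = b i.

Lemma exponentS k a : exponent k.+1 a = (exponent k a + v k *+ a k)%MM.
Proof. by rewrite /exponent big_ord_recr. Qed.

(** Used to change or to fix the last multiplicity when descending from [k + 1]
to [k] generators. *)
Lemma exponent_update k a x :
  exponent k.+1 (fun i => if i == k then x else a i) = (exponent k a + v k *+ x)%MM.
Proof.
rewrite exponentS eqxx; congr (_ + _)%MM; apply: eq_bigr => i _.
by rewrite ltn_eqF.
Qed.

Lemma independent_pred k : independent k.+1 -> independent k.
Proof.
move=> ind a b ab i ik.
pose upd e i := if i == k then 0%N else e i.
have := ind (upd a) (upd b).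
rewrite !exponent_update ab => /(_ erefl i (leqW ik)).
by rewrite /upd ltn_eqF.
Qed.

Lemma tower_eval_supp k (p : poly_tower K k) m :
  m \in msupp (tower_eval k p) -> exists a, m = exponent k a.
Proof.
elim: k p m => [|k IHk] p m.
  rewrite /= msuppC; case: eqP => // _; rewrite inE => /eqP ->.
  by exists (fun=> 0%N); rewrite /exponent big_ord0.
rewrite tower_evalS => /(msupp_sum_le (x:=m))/flatten_mapP[i _].
rewrite mpolyXn (perm_mem (msuppMX _ _)) => /mapP[m' /IHk[a ->] ->].
exists (fun j => if j == k then i : nat else a j).
by rewrite exponent_update addmC.
Qed.

(** In the value of a polynomial in the last variable, the terms of different
degree have disjoint supports by independence, so each of them vanishes. *)
Lemma tower_eval_eq0 k (p : poly_tower K k) :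
  independent k -> tower_eval k p = 0 -> p = 0.
Proof.
move=> ind; elim: k ind p => [|k IHk] ind p.
  by move=> /eqP; rewrite /= mpolyC_eq0 => /eqP.
have {}IHk := IHk (independent_pred ind).
rewrite tower_evalS => p0; apply/polyP => j; rewrite coef0; apply: IHk.
have [jp|pj] := ltnP j (size p); last by rewrite nth_default ?rmorph0.
apply/mpolyP => m; rewrite mcoeff0.
have [|mp] := boolP (m \in msupp (tower_eval k p`_j)); last exact: memN_msupp_eq0.
move=> /tower_eval_supp[a ma].
have := congr1 (mcoeff (m + v k *+ j)) p0; rewrite mcoeff0 => <-.
rewrite raddf_sum /= (bigD1 (Ordinal jp)) //= mpolyXn addmC mcoeffMX.
rewrite big1 ?addr0 // => i ij.
rewrite mpolyXn; apply: memN_msupp_eq0; rewrite (perm_mem (msuppMX _ _)).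
apply/mapP => -[m' /tower_eval_supp[b ->]]; rewrite ma => e.
have := ind (fun l => if l == k then j else a l)
            (fun l => if l == k then i : nat else b l).
rewrite !exponent_update addmC e addmC => /(_ erefl k (ltnSn k)).
by rewrite eqxx => ji; move: ij; rewrite -val_eqE /= ji eqxx.
Qed.

Lemma tower_eval_inj k : independent k -> injective (tower_eval k).
Proof. by move=> ind; apply: raddf_inj => p; exact: tower_eval_eq0. Qed.

Definition first_monomials k : set S :=
  [set f | exists2 i, (i < k)%N & f = 'X_[v i]].

Lemma tower_eval_subalg k (p : poly_tower K k) : forall j, (k <= j)%N ->
  tower_eval k p \in subalg_gen (first_monomials j).
Proof.
elim: k p => [|k IHk] p j kj.
  apply/asboolP => P [P1 PZ PM] _; rewrite /= -alg_mpolyC.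
  (* A constant p is the combination (p - 1) * 1 + 1 of members of P. *)
  have := PZ (p - 1) 1 1 P1 P1.
  by rewrite scalerBl scale1r subrK.
have [h1 hZ hM] := subalg_gen_closed (first_monomials j).
rewrite tower_evalS; apply: rpred_sum => i _; apply: rpredM; first exact/IHk/ltnW.
apply: rpredX; apply/asboolP => P _; apply; by exists k.
Qed.

Lemma gorenstein_monomial_subalg k : independent k ->
  gorenstein (subalg (first_monomials k)).
Proof.
move=> ind.
pose B := subalg (first_monomials k).
pose f p : B := exist (fun g : S => g \in subalg_gen (first_monomials k)) _
  (tower_eval_subalg p (leqnn k)).
have fZ : zmod_morphism f by move=> x y; apply: val_inj; rewrite /= rmorphB.
have fM : monoid_morphism f.
  by split=> [|x y]; apply: val_inj; rewrite /= ?rmorph1 ?rmorphM.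
pose aZ := GRing.isZmodMorphism.Build _ _ f fZ.
pose aM := GRing.isMonoidMorphism.Build _ _ f fM.
pose F : {rmorphism poly_tower K k -> B} := HB.pack f aZ aM.
apply: (@gorenstein_iso _ _ F _ _ (gorenstein_poly_tower K k)).
  by move=> x y /(congr1 val) /=; exact: tower_eval_inj.
pose im : {pred S} := fun g => `[< exists x, tower_eval k x = g >].
have im_closed : GRing.subalg_closed im.
  split.
  - by apply/asboolP; exists 1; rewrite rmorph1.
  - move=> a _ _ /asboolP[x <-] /asboolP[y <-]; apply/asboolP.
    exists (tower_const K k a * x + y).
    by rewrite rmorphD rmorphM /= tower_eval_const mul_mpolyC.
  - move=> _ _ /asboolP[x <-] /asboolP[y <-]; apply/asboolP.
    by exists (x * y); rewrite rmorphM.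
have im_gen w : first_monomials k w -> w \in im.
  move=> [i ik ->]; apply/asboolP.
  elim: k ik {ind B f fZ fM aZ aM F im im_closed} => // k IHk.
  rewrite ltnS leq_eqVlt => /orP[/eqP ->|/IHk[x <-]].
    by exists 'X; exact: tower_evalX.
  by exists x%:P; exact: tower_evalC.
move=> [g gP]; have /asboolP/(_ _ im_closed im_gen)/asboolP[x xg] := gP.
by exists x; apply: val_inj.
Qed.

End MonomialAlgebra.

(** * Monomial ideals *)

Section MonomialIdeals.
Variables (K : fieldType) (n : nat).
Local Notation S := {mpoly K[n]}.
Implicit Types (T : set 'X_{1..n}).

Definition monomials_of T : set S := [set f | exists2 a, T a & f = 'X_[a]].

(** The monomial ideal generated by the [x^a] with [a] in [T], described by
divisibility; it is used as an upper bound for ideals given by generators. *)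
Definition supported_above T : set S :=
  [set f | forall m, m \in msupp f -> exists2 a, T a & (a <= m)%MM].

Lemma supported_aboveM T1 T2 T f g :
  (forall a b, T1 a -> T2 b -> T (a + b)%MM) ->
  supported_above T1 f -> supported_above T2 g -> supported_above T (f * g).
Proof.
move=> TD f1 g2 m /msuppM_le /allpairsP[[m1 m2] /= [/f1[a Ta am] /g2[b Tb bm] ->]].
exists (a + b)%MM; [exact: TD | apply/mnm_lepP => i].
by rewrite !mnmDE leq_add //; [exact: (mnm_lepP am) | exact: (mnm_lepP bm)].
Qed.

Lemma supported_above_ideal T : is_ideal (supported_above T).
Proof.
split.
- by move=> m; rewrite msupp0.
- by move=> f g fT gT m /msuppD_le; rewrite mem_cat => /orP[/fT|/gT].
- move=> f g gT m /msuppM_le /allpairsP[[m1 m2] /= [_ /gT[a Ta am] ->]].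
  by exists a => //; apply: lepm_trans am _; exact: lem_addl.
Qed.

Lemma monomials_supported T : monomials_of T `<=` supported_above T.
Proof.
move=> _ [a Ta ->] m; rewrite msuppX inE => /eqP ->.
by exists a => //; exact: lepm_refl.
Qed.

Lemma ideal_gen_supported T : ideal_gen (monomials_of T) `<=` supported_above T.
Proof.
apply: ideal_gen_min; first exact: supported_above_ideal.
exact: monomials_supported.
Qed.

Lemma ideal_genX T a m : T a -> (a <= m)%MM -> ideal_gen (monomials_of T) 'X_[m].
Proof.
move=> Ta /submK <-; rewrite mpolyXD.
have [_ _ IM] := ideal_gen_ideal (monomials_of T).
by apply: IM; apply: sub_ideal_gen; exists a.
Qed.

Lemma lepm_mdeg_eq (a m : 'X_{1..n}) : (a <= m)%MM -> (mdeg m <= mdeg a)%N -> a = m.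
Proof.
move=> am; rewrite -{1}(submK am) mdegD -{2}[mdeg a]add0n leq_add2r leqn0 mdeg_eq0.
by move=> /eqP ma; rewrite -[RHS](submK am) ma add0m.
Qed.

Lemma monomial_mem_gen (W : set S) a :
  W `<=` @monomials K n -> ideal_gen W 'X_[a] -> exists2 b, W 'X_[b] & (b <= a)%MM.
Proof.
move=> Wmon; pose T := [set b | W 'X_[b]].
have WT : W `<=` ideal_gen (monomials_of T).
  move=> w Ww; apply: sub_ideal_gen; have [b wb] := Wmon _ Ww.
  by exists b => //; rewrite /T /= -wb.
by move=> /(ideal_gen_le WT)/ideal_gen_supported; apply; rewrite msuppX inE.
Qed.

(** Monomials of equal degree do not divide one another, so each of them has to
occur in every set of monomials generating the same ideal. *)
Lemma min_monomial_gens_equigenerated T d : (forall a, T a -> mdeg a = d) ->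
  min_monomial_gens (ideal_gen (monomials_of T)) = monomials_of T.
Proof.
move=> Td.
have Tmon : monomials_of T `<=` @monomials K n by move=> _ [a _ ->]; exists a.
have TW (W : set S) : W `<=` @monomials K n ->
    ideal_gen W = ideal_gen (monomials_of T) -> monomials_of T `<=` W.
  move=> Wmon WE _ [a Ta ->].
  have [|b Wb ba] := @monomial_mem_gen W a Wmon.
    by rewrite WE; apply: sub_ideal_gen; exists a.
  have : ideal_gen (monomials_of T) 'X_[b] by rewrite -WE; exact: sub_ideal_gen.
  move=> /ideal_gen_supported/(_ b); rewrite msuppX inE eqxx.
  move=> /(_ isT)[a' Ta' a'b].
  suff -> : a = b by [].
  apply/esym/(lepm_mdeg_eq ba).
  by rewrite (Td _ Ta) -(Td _ Ta') -(submK a'b) mdegD leq_addl.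
apply: xget_unique.
  split=> // W WT WE; rewrite eqEsubset; split=> //; apply: TW => //.
  exact: subset_trans WT Tmon.
by move=> W [Wmon WE Wmin]; apply/esym/Wmin => //; exact: TW.
Qed.

End MonomialIdeals.

(** * Powers of the edge ideal of the complete graph *)

Section CompleteGraph.
Variables (K : fieldType) (n : nat) (c : 'I_n -> nat).
Local Notation S := {mpoly K[n]}.
Local Notation E := (@edge_ideal K n (@complete_graph n)).

Definition balanced q : set 'X_{1..n} :=
  [set a | mdeg a = q.*2 /\ forall i, (a i <= q)%N].

Lemma edge_ideal_supported : E `<=` supported_above (balanced 1).
Proof.
apply: ideal_gen_min; first exact: supported_above_ideal.
move=> _ [i [j [ij ->]]]; rewrite -mpolyXD => m; rewrite msuppX inE => /eqP ->.
exists (U_(i) + U_(j))%MM; last exact: lepm_refl.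
split=> [|k]; first by rewrite mdegD !mdeg1.
rewrite mnmDE !mnm1E; have [ik|_] := eqVneq i k; last by case: eqP.
have [jk|//] := eqVneq j k.
by move: ij; rewrite /complete_graph ik jk eqxx.
Qed.

Lemma edge_ideal_pow_supported q : ideal_pow E q `<=` supported_above (balanced q).
Proof.
apply: ideal_gen_min; first exact: supported_above_ideal.
elim: q => [|q IHq] _ [g gE ->].
  rewrite big_ord0 => m; rewrite msupp1 inE => /eqP ->.
  exists 0%MM; last exact: lepm_refl.
  by split=> [|i]; rewrite ?mdeg0 ?mnm0E.
rewrite big_ord_recl; apply: (@supported_aboveM _ _ (balanced 1) (balanced q)).
- move=> a b [a2 a1] [b2 bq]; split; first by rewrite mdegD a2 b2.
  by move=> i; rewrite mnmDE -add1n leq_add.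
- exact: edge_ideal_supported.
- by apply: IHq; exists (fun i => g (lift ord0 i)).
Qed.

Lemma exists_gt0 (P : pred 'I_n) (a : 'I_n -> nat) :
  (0 < \sum_(i | P i) a i)%N -> exists2 i, P i & (0 < a i)%N.
Proof.
move=> a0; apply: contrapT => no; move: a0; rewrite big1 // => i Pi.
by apply/eqP; rewrite -leqn0 leqNgt; apply/negP => ai; apply: no; exists i.
Qed.

(** Take for [i] and [j] the positions of the two largest exponents. An exponent
equal to [q + 1] at a third position would force three exponents to be equal to
[q + 1], which exceeds the degree [2 (q + 1)]. *)
Lemma balanced_edge q a : balanced q.+1 a -> exists i j,
  [/\ i != j, (U_(i) + U_(j) <= a)%MM & balanced q (a - (U_(i) + U_(j)))%MM].
Proof.
move=> [a2 aq]; have := a2; rewrite mdegE => asum.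
have [|i0 _ ai0] := @exists_gt0 xpredT a; first by rewrite asum.
case: (@arg_maxnP _ i0 xpredT a isT) => i _ imax.
have := asum; rewrite (bigD1 i) //= => asum1; have aiq := aq i.
have [|j0 j0i aj0] := @exists_gt0 (fun k => k != i) a.
  by rewrite -(ltn_add2l (a i)) asum1; lia.
case: (@arg_maxnP _ j0 (fun k => k != i) a j0i) => j ji jmax.
have aj : (0 < a j)%N by exact: leq_trans aj0 (jmax _ j0i).
have ai : (0 < a i)%N by exact: leq_trans ai0 (imax _ isT).
have le : (U_(i) + U_(j) <= a)%MM.
  apply/mnm_lepP => k; rewrite mnmDE !mnm1E.
  by case: eqP => [<-|_]; [rewrite (negbTE ji) | case: eqP => [<-|]].
exists i, j; split=> //; first by rewrite eq_sym.
split.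
  have := congr1 mdeg (submK le); rewrite !mdegD !mdeg1 a2; lia.
move=> k; rewrite mnmBE mnmDE !mnm1E.
have [<-|ik] := eqVneq i k; first by have := aq i; lia.
have [<-|jk] := eqVneq j k; first by have := aq j; lia.
have := asum1; rewrite (bigD1 j) //= (bigD1 k) /=; last by rewrite eq_sym ik eq_sym.
have := imax j isT; have := jmax k; rewrite eq_sym ik => /(_ isT); lia.
Qed.

Lemma balanced_edge_ideal_pow q a : balanced q a -> ideal_pow E q 'X_[a].
Proof.
move=> aq; apply: sub_ideal_gen.
elim: q a aq => [|q IHq] a aq.
  exists (fun=> 0); first by case.
  rewrite big_ord0; have [/eqP + _] := aq; rewrite mdeg_eq0 => /eqP ->.
  by rewrite mpolyX0.
have [i [j [ij le /IHq[g gE gP]]]] := balanced_edge aq.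
exists (fun k => oapp g ('X_i * 'X_j) (unlift ord0 k)).
  move=> k; case: unliftP => [l _|_] /=; first exact: gE.
  by apply: sub_ideal_gen; exists i, j.
rewrite big_ord_recl unlift_none /= -(submK le) mpolyXD gP mulrC -mpolyXD.
by congr (_ * _); apply: eq_bigr => k _; rewrite liftK.
Qed.

Definition bounded_balanced q : set 'X_{1..n} :=
  [set a | balanced q a /\ forall i, (a i <= c i)%N].

Lemma bounded_part_edge_ideal_pow q :
  bounded_part c (ideal_pow E q) =
  ideal_gen (@monomials_of K n (bounded_balanced q)).
Proof.
rewrite eqEsubset; split; apply: ideal_gen_le.
  move=> _ [m [-> mE mc]].
  have [|a aq am] := edge_ideal_pow_supported mE (m := m).
    by rewrite msuppX inE.
  apply: (@ideal_genX K n (bounded_balanced q) a m _ am); split=> // i.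
  exact: leq_trans (mnm_lepP am i) (mc i).
move=> _ [a [aq ac] ->]; apply: sub_ideal_gen; exists a; split=> //.
exact: balanced_edge_ideal_pow.
Qed.

Lemma bounded_pow_neq0_edge_ideal q :
  bounded_pow_neq0 c E q <-> exists a, bounded_balanced q a.
Proof.
rewrite /bounded_pow_neq0 bounded_part_edge_ideal_pow; split.
  move=> [f /ideal_gen_supported fT f0].
  have : mlead f \in msupp f by rewrite mlead_supp.
  by move=> /fT[a Ta _]; exists a.
move=> [a Ta]; exists 'X_[a]; first by apply: sub_ideal_gen; exists a.
by rewrite -msupp_eq0 msuppX.
Qed.

Lemma delta_edge_ideal d : (exists a, bounded_balanced d a) ->
  (forall q a, bounded_balanced q a -> (q <= d)%N) -> delta c E = d.
Proof.
move=> dT dmax; apply: xget_unique.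
  split; first exact/bounded_pow_neq0_edge_ideal.
  by move=> q /bounded_pow_neq0_edge_ideal[a /dmax].
move=> q [/bounded_pow_neq0_edge_ideal[a /dmax qd] qmax].
apply/eqP; rewrite eqn_leq qd; apply: qmax.
exact/bounded_pow_neq0_edge_ideal.
Qed.

(** Reduces the theorem to counting: it is enough to find the largest [d] for
which there is a [d]-balanced exponent below [c], and to check that the
exponents for this [d] are independent. *)
Lemma toric_ring_complete_gorenstein d k (v : nat -> 'X_{1..n}) :
  (forall q a, bounded_balanced q a -> (q <= d)%N) ->
  (forall a, bounded_balanced d a <-> exists2 i, (i < k)%N & a = v i) ->
  (0 < k)%N -> independent v k ->
  gorenstein (toric_ring K c (@complete_graph n)).
Proof.
move=> dmax dE k0 ind.
have dT : exists a, bounded_balanced d a by exists (v 0%N); apply/dE; exists 0%N.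
rewrite /toric_ring (delta_edge_ideal dT dmax) bounded_part_edge_ideal_pow.
rewrite (@min_monomial_gens_equigenerated _ _ _ d.*2); last by move=> a [[]].
have -> : @monomials_of K n (bounded_balanced d) = first_monomials v k.
  rewrite predeqE => f; split=> [[a /dE[i ik ->] ->]|[i ik ->]]; first by exists i.
  by exists (v i) => //; apply/dE; exists i.
exact: gorenstein_monomial_subalg.
Qed.

End CompleteGraph.

(** * The toric ring of the complete graph *)

Lemma complete_graph_is_graph n : (2 <= n)%N -> is_graph (@complete_graph n).
Proof.
move=> n2; split.
- by move=> i j; rewrite /complete_graph eq_sym.
- by move=> i; rewrite /complete_graph eqxx.
- move=> i; have n0 := ltnW n2.
  have [i0|i0] := eqVneq (i : nat) 0%N.
    by exists (Ordinal n2); rewrite /complete_graph -val_eqE /= i0.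
  by exists (Ordinal n0); rewrite /complete_graph -val_eqE.
Qed.

Section GeneratorsCount.
Variables (K : fieldType) (n : nat) (c : 'I_n -> nat).
Hypotheses (hn : (2 <= n)%N) (hc : forall i, (0 < c i)%N).

Definition bound_mnm : 'X_{1..n} := [multinom c i | i < n].
Local Notation total := (mdeg bound_mnm).

Lemma bound_mnmE i : bound_mnm i = c i. Proof. exact: mnmE. Qed.

Lemma bounded_lepm q a : bounded_balanced c q a -> (a <= bound_mnm)%MM.
Proof. by move=> [_ ac]; apply/mnm_lepP => i; rewrite bound_mnmE. Qed.

Lemma bounded_mdeg q a : bounded_balanced c q a -> (q.*2 <= total)%N.
Proof.
move=> qa; have le := bounded_lepm qa; case: qa => -[<- _] _.
by rewrite -(submK le) mdegD leq_addl.
Qed.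

Lemma independent1 (w : 'X_{1..n}) : mdeg w != 0%N -> independent (fun=> w) 1.
Proof.
move=> w0 a b; rewrite /independent /exponent !big_ord1 => /(congr1 mdeg).
rewrite !mdegMn => /eqP; rewrite eqn_pmul2l ?lt0n// => /eqP ab.
by case.
Qed.

Lemma total_ge2 : (2 <= total)%N.
Proof.
rewrite mdegE (leq_trans hn)//.
rewrite -[X in (X <= _)%N]card_ord -sum1_card; apply: leq_sum => i _.
by rewrite bound_mnmE.
Qed.

(** A [q]-balanced exponent has at least [q] of its degree [2q] outside
position [i0], where at most the sum [r] of the other bounds is available. So
[q <= r], and equality forces the exponent to be [r] at [i0] and equal to [c]
elsewhere. *)
Lemma dominated_gorenstein i0 : (total <= (c i0).*2)%N ->
  gorenstein (toric_ring K c (@complete_graph n)).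
Proof.
move=> dom; have := mdegE bound_mnm; rewrite (bigD1 i0) //= bound_mnmE.
set r := (\sum_(i < n | i != i0) bound_mnm i)%N => totalE.
have ri0 : (r <= c i0)%N by lia.
pose w : 'X_{1..n} := [multinom (if i == i0 then r else c i) | i < n].
have wdeg : mdeg w = r.*2.
  rewrite mdegE (bigD1 i0) //= mnmE eqxx -addnn; congr (_ + _)%N.
  by apply: eq_bigr => i /negbTE ii0; rewrite mnmE ii0 bound_mnmE.
have wbal : bounded_balanced c r w.
  split; last by move=> i; rewrite mnmE; case: eqP => [->|].
  split=> // i; rewrite mnmE; case: eqVneq => // ii0.
  by rewrite /r (bigD1 i) //= bound_mnmE leq_addr.
have bal q a : bounded_balanced c q a -> (q <= r)%N /\ (q = r -> a = w).
  move=> [[a2 aq] ac]; have := mdegE a; rewrite (bigD1 i0) //= a2 => asum.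
  have aqi := aq i0.
  have le : (\sum_(i < n | i != i0) a i <= r)%N.
    by apply: leq_sum => i _; rewrite bound_mnmE.
  split=> [|qr]; first by have := leq_add aqi le; rewrite -asum; lia.
  have aw i : (a i <= w i)%N by rewrite mnmE; case: eqVneq => [->|] //; rewrite -qr.
  by apply: lepm_mdeg_eq; [exact/mnm_lepP | rewrite wdeg a2 qr].
apply: (@toric_ring_complete_gorenstein K n c r 1 (fun=> w)) => //.
- by move=> q a /bal[].
- move=> a; split=> [/bal[_ aw]|[_ _ ->] //]; exists 0%N => //; exact: aw.
- apply: independent1; rewrite wdeg double_eq0 -lt0n.
  have [_ _ /(_ i0)[j]] := complete_graph_is_graph hn.
  rewrite /complete_graph eq_sym => ji0.
  by rewrite /r (bigD1 j) //= bound_mnmE ltn_addr.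
Qed.

Lemma undominated_even_gorenstein : (forall i, (c i).*2 < total)%N ->
  ~~ odd total -> gorenstein (toric_ring K c (@complete_graph n)).
Proof.
move=> undom ev; have t2 := total_ge2.
have totalE : total = total./2.*2 by rewrite -[LHS]odd_double_half (negbTE ev).
apply: (@toric_ring_complete_gorenstein K n c total./2 1 (fun=> bound_mnm)) => //.
- by move=> q a /bounded_mdeg; lia.
- move=> a; split=> [ba|[_ _ ->]].
    exists 0%N => //; apply: lepm_mdeg_eq (bounded_lepm ba) _.
    by case: ba => -[-> _ _]; rewrite -totalE.
  split=> [|i]; last by rewrite bound_mnmE.
  by split=> // i; have := undom i; rewrite bound_mnmE; lia.
- by apply: independent1; lia.
Qed.

(** The generators are the [x^c / x_i]. A relation with multiplicities [e i]
has coordinates [c k * (e 0 + ... + e (n-1)) - e k] and total degree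
[(|c| - 1) * (e 0 + ... + e (n-1))]; the degree determines the sum of the
multiplicities since [|c| > 1], and the coordinates each of them. *)
Lemma undominated_odd_gorenstein : (forall i, (c i).*2 < total)%N ->
  odd total -> gorenstein (toric_ring K c (@complete_graph n)).
Proof.
move=> undom od; have t2 := total_ge2.
have totalE : total = total./2.*2.+1 by rewrite -[LHS]odd_double_half od.
(* The default vertex i0 only makes v total; v is used below n. *)
have i0 : 'I_n by exact: Ordinal (ltnW hn).
pose v i : 'X_{1..n} := (bound_mnm - U_(insubd i0 i))%MM.
have leU i : (U_(i) <= bound_mnm)%MM by rewrite lep1mP bound_mnmE -lt0n.
have vdeg i : (mdeg (v i)).+1 = total.
  by rewrite -(submK (leU (insubd i0 i))) mdegD mdeg1 addn1.
apply: (@toric_ring_complete_gorenstein K n c total./2 n v) => //.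
- by move=> q a /bounded_mdeg; lia.
- move=> a; split=> [ba|[i _ ->]].
    have le := bounded_lepm ba.
    have /mdeg1P[i /eqP ai] : mdeg (bound_mnm - a)%MM == 1%N.
      have := congr1 mdeg (submK le); rewrite mdegD; case: ba => -[-> _ _].
      by move=> h; apply/eqP; lia.
    exists i => //; rewrite /v valKd -ai.
    by apply/mnmP => k; rewrite !mnmBE subKn//; move/mnm_lepP: le.
  split.
    split; first by have := vdeg i; lia.
    move=> k; rewrite mnmBE bound_mnmE; have := undom k; lia.
  by move=> k; rewrite mnmBE bound_mnmE leq_subr.
- exact: ltnW.
- move=> a b ab.
  have expdeg e : mdeg (exponent v n e) = (total.-1 * \sum_(i < n) e i)%N.
    rewrite mdeg_sum big_distrr; apply: eq_bigr => i _ /=.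
    by rewrite mdegMn -(vdeg i).
  have sab : (\sum_(i < n) a i = \sum_(i < n) b i)%N.
    have := congr1 mdeg ab; rewrite !expdeg => /eqP.
    by rewrite eqn_pmul2l; [move/eqP | lia].
  have expE e (k : 'I_n) : (exponent v n e k + e k = c k * \sum_(i < n) e i)%N.
    rewrite mnm_sumE big_distrr (bigD1 k) //= [in RHS](bigD1 k) //=.
    rewrite addnAC; congr (_ + _)%N.
      rewrite mulmnE /v valKd mnmBE mnm1E eqxx bound_mnmE.
      by rewrite mulnBl mul1n subnK// leq_pmull.
    apply: eq_bigr => i ik.
    by rewrite mulmnE /v valKd mnmBE mnm1E (negbTE ik) bound_mnmE subn0.
  move=> i ik; have := expE a (Ordinal ik); rewrite ab sab -(expE b) /=.
  by move/eqP; rewrite eqn_add2l => /eqP.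
Qed.

Lemma toric_ring_complete_graph : gorenstein (toric_ring K c (@complete_graph n)).
Proof.
have [[i0 dom]|undom] := pselect (exists i, total <= (c i).*2)%N.
  exact: dominated_gorenstein dom.
have undom' i : ((c i).*2 < total)%N.
  by rewrite ltnNge; apply/negP => dom; apply: undom; exists i.
have [od|ev] := boolP (odd total).
  exact: undominated_odd_gorenstein.
exact: undominated_even_gorenstein.
Qed.

End GeneratorsCount.

Theorem theorem2p2 (K : fieldType) (n : nat) (hn : (2 <= n)%N)
    (c : 'I_n -> nat) (hc : forall i, (0 < c i)%N) :
  gorenstein (toric_ring K c (@complete_graph n)) /\
  exists e : rel 'I_n, is_graph e /\ gorenstein (toric_ring K c e).
Proof.
have gor := toric_ring_complete_graph K hn hc.
split=> //; exists (@complete_graph n); split=> //.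
exact: complete_graph_is_graph.
Qed.
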